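(* Let $k=2$ and let $c_1\le c_2$ be real numbers. Consider the two-dimensional forward-Euler DDG scheme on rectangular meshes for $\partial_tu=\nabla\cdot(A\nabla u)$, where $A(x,y,u)=\begin{pmatrix}a&c\\c&b\end{pmatrix}$ is nonnegative definite, with periodic boundary conditions: given $u_h^n\in V_h$, find $u_h^{n+1}\in V_h$ such that for all $v\in V_h$ and all $i,j$, $$\begin{aligned}\int_{K_{ij}}u_h^{n+1}v\,dxdy=&\int_{K_{ij}}u_h^nv\,dxdy-\tau\int_{K_{ij}}A_h^n\nabla u_h^n\cdot\nabla v\,dxdy\\&+\tau\int_{\partial K_{ij}}\{A_h^n\}\widehat{\nabla u_h^n}\cdot\nu\,v\,ds+\tau\int_{\partial K_{ij}}\{A_h^n\}\nabla v\cdot\nu\,(u_h^n-\{u_h^n\})\,ds,\end{aligned}$$ with the update of cell averages evaluated by an $L$-point Gauss–Lobatto rule as specified in the context. Put $$\|c\|_\infty=\max_{(x,y)\in\Omega,\,u\in[c_1,c_2]}|c(x,y,u)|,\qquad\min\{a,b\}=\min_{(x,y)\in\Omega,\,u\in[c_1,c_2]}\{a(x,y,u),b(x,y,u)\},$$ $$\max\{a,b\}=\max_{(x,y)\in\Omega,\,u\in[c_1,c_2]}\{a(x,y,u),b(x,y,u)\}.$$ Assume the mesh is regularly shaped, i.e. $\kappa^{-1}\le\frac{\Delta x}{\Delta y}\le\kappa$ for some constant $\kappa>0$, and that the flux parameters $(\beta_0,\beta_1)$ satisfy $$\beta_0\ge1+\frac{2\kappa\|c\|_\infty L(L-1)}{(1-\gamma)\min\{a,b\}}\quad\text{and}\quad\tfrac18\le\beta_1\le\tfrac14,$$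 and $\gamma=\max\{|\gamma^x|,|\gamma^y|\}\le8\beta_1-1$. If $u_h^n(x,y)\in[c_1,c_2]$ for all $(x,y)\in S_{ij}$ and all $i,j$, then there exists $\mu_0>0$ such that if $\mu=\frac{\tau}{(\Delta x)^2}+\frac{\tau}{(\Delta y)^2}\le\mu_0$, the cell averages satisfy $\bar u_{ij}^{n+1}\in[c_1,c_2]$ for all $i,j$. More precisely, $$\mu_0=\min\left\{\frac{1-3\gamma}{6\max\{a,b\}\big(\beta_0+\frac{8\beta_1-2}{1+\gamma}\big)(1-\gamma)+12\kappa\|c\|_\infty L(L-1)},\ \frac{1}{6\max\{a,b\}(1-4\beta_1)}\right\}.$$
   Context: Mesh and space. $\Omega=I\times J$ is a rectangle partitioned into $K_{ij}=I_i\times J_j$, $I_i=[x_{i-\frac12},x_{i+\frac12}]$, $J_j=[y_{j-\frac12},y_{j+\frac12}]$, $1\le i\le N_x$, $1\le j\le N_y$, uniform with sides $\Delta x,\Delta y$ and cell centers $(x_i,y_j)$; periodic boundary conditions (indices and traces are periodic). $V_h=\{v\in L^2(\Omega):v|_{K_{ij}}\in Q^k(K_{ij})\}$, with $Q^k(K_{ij})$ the tensor product of polynomials of degree at most $k$ in $x$ and in $y$. $\tau>0$ is the time step; $\nu$ is the outward unit normal; $A_h^n=A(x,y,u_h^n)$ with entries $a_h^n,b_h^n,c_h^n$. Across an interface, $[v]=v^+-v^-$ and $\{v\}=\frac12(v^++v^-)$, where $+$ is the right (resp. upper) side. Flux $\widehat{\nabla u_h}=(\widehat{\partial_xu_h},\widehat{\partial_yu_h})^\top$: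 on $x=x_{i+\frac12}$, $\widehat{\partial_xu_h}=\frac{\beta_0}{\Delta x}[u_h]+\{\partial_xu_h\}+\beta_1\Delta x[\partial_x^2u_h]$ and $\widehat{\partial_yu_h}=\{\partial_yu_h\}$; on $y=y_{j+\frac12}$, $\widehat{\partial_yu_h}=\frac{\beta_0}{\Delta y}[u_h]+\{\partial_yu_h\}+\beta_1\Delta y[\partial_y^2u_h]$ and $\widehat{\partial_xu_h}=\{\partial_xu_h\}$. Cell averages. $\bar u_{ij}=\frac1{\Delta x\Delta y}\int_{K_{ij}}u_h\,dxdy$. Put $\mu_x=\frac\tau{(\Delta x)^2}$, $\mu_y=\frac\tau{(\Delta y)^2}$, $\mu=\mu_x+\mu_y$. Taking $v=1$ on $K_{ij}$, the scheme gives $$\bar u_{ij}^{n+1}=\frac{\mu_x}\mu\,\frac1{\Delta y}\int_{J_j}H_1(y)\,dy+\frac{\mu_y}\mu\,\frac1{\Delta x}\int_{I_i}H_2(x)\,dx+B,$$ $$H_1(y)=\frac1{\Delta x}\int_{I_i}u_h^n\,dx+\mu\Delta x\,\{a_h^n\}\widehat{\partial_xu_h^n}\Big|_{x_{i-\frac12}}^{x_{i+\frac12}},\qquad H_2(x)=\frac1{\Delta y}\int_{J_j}u_h^n\,dy+\mu\Delta y\,\{b_h^n\}\widehat{\partial_yu_h^n}\Big|_{y_{j-\frac12}}^{y_{j+\frac12}},$$ $$B=\frac{\tau}{\Delta x\Delta y}\Big[\int_{J_j}\{c_h^n\}\{\partial_yu_h^n\}\,dy\Big|_{x_{i-\frac12}}^{x_{i+\frac12}}+\int_{I_i}\{c_h^n\}\{\partial_xu_h^n\}\,dx\Big|_{y_{j-\frac12}}^{y_{j+\frac12}}\Big].$$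 Quadrature. $\hat S_i^x=\{x_{i-\frac12}=\hat x_i^1<\dots<\hat x_i^L=x_{i+\frac12}\}$ and $\hat S_j^y=\{y_{j-\frac12}=\hat y_j^1<\dots<\hat y_j^L=y_{j+\frac12}\}$ are the $L$-point Gauss–Lobatto nodes on $I_i$, $J_j$, $L\ge\frac{k+3}2$, with weights $\hat\omega^\sigma$, $\sum_{\sigma=1}^L\hat\omega^\sigma=1$. The integrals of $H_1$ and $H_2$ on the right-hand side are evaluated with this rule, giving the scheme $$\bar u_{ij}^{n+1}=\frac{\mu_x}\mu\sum_{\sigma=1}^L\hat\omega^\sigma H_1(\hat y_j^\sigma)+\frac{\mu_y}\mu\sum_{\sigma=1}^L\hat\omega^\sigma H_2(\hat x_i^\sigma)+B.$$ Test set. $\gamma^x,\gamma^y\in(-\frac13,\frac13)$ with $|\gamma^x|,|\gamma^y|\le8\beta_1-1$. With $S_i^x=x_i+\frac{\Delta x}2\{-1,\gamma^x,1\}$ and $S_j^y=y_j+\frac{\Delta y}2\{-1,\gamma^y,1\}$, set $S_{ij}=(S_i^x\otimes\hat S_j^y)\cup(\hat S_i^x\otimes S_j^y)$; values of $u_h^n$ on $S_{ij}$ are those of $u_h^n|_{K_{ij}}$. A quotient with zero denominator in $\mu_0$ is read as $+\infty$.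
   Formalization: The formal theorem additionally assumes |c(x,y,u_h^n)| ≤ ‖c‖_∞ at every point of the cell edges (for each trace), since u_h^n may leave [c_1,c_2] between quadrature nodes; without this the claim is false. *)

(* Defs.v *)
From HB Require Import structures.
From mathcomp Require Import all_boot all_order all_algebra.
From mathcomp Require Import all_classical all_reals all_analysis.

Set Implicit Arguments.
Unset Strict Implicit.
Unset Printing Implicit Defensive.

Import Order.TTheory GRing.Theory Num.Theory.
Import numFieldNormedType.Exports.

Local Open Scope classical_set_scope.
Local Open Scope ring_scope.

Section Extrema.
Variable R : realType.

Definition is_max (S : set R) (m : R) : Prop := S m /\ ubound S m.
Definition is_min (S : set R) (m : R) : Prop := S m /\ lbound S m.

End Extrema.

Section Mat2.
Variable R : realType.

Definition vec2 (p q : R) : 'cV[R]_2 :=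
  \col_(i < 2) (if i == 0 then p else q).

(* The matrix with rows (a, c) and (c, b). *)
Definition sym2 (a b c : R) : 'M[R]_2 :=
  \matrix_(i < 2, j < 2) (if i == j then (if i == 0 then a else b) else c).

Definition dot (v w : 'cV[R]_2) : R := (v^T *m w) 0 0.

Definition nonneg_definite (A : 'M[R]_2) : Prop :=
  forall v : 'cV[R]_2, 0 <= dot v (A *m v).

End Mat2.

Section GaussLobatto.
Variable R : realType.

(* The L-point Gauss-Lobatto rule on [-1, 1], with weights normalized to
   sum to 1: the rule whose nodes include both endpoints and which integrates
   every polynomial of degree <= 2L - 3 exactly.  This determines the nodes
   and the weights; [p = 1] gives that the weights sum to 1. *)
Definition gauss_lobatto (L : nat) (node weight : 'I_L -> R) : Prop :=
  [/\ {homo node : s t / (s < t)%N >-> s < t},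
      forall s : 'I_L, s = 0%N :> nat -> node s = -1,
      forall s : 'I_L, s = L.-1 :> nat -> node s = 1 &
      forall p : {poly R}, (size p <= 2 * L - 2)%N ->
        \sum_s weight s * p.[node s] =
        2^-1 * \int[lebesgue_measure]_(x in `[-1, 1]) p.[x]].

End GaussLobatto.

Record mesh (R : realType) := Mesh {
  xmin : R; xmax : R; ymin : R; ymax : R;
  nx : nat; ny : nat;
  _ : xmin < xmax;
  _ : ymin < ymax;
  _ : (0 < nx)%N;
  _ : (0 < ny)%N }.

Section Mesh.
Variables (R : realType) (M : mesh R).
Local Notation Ix := 'I_(nx M).
Local Notation Iy := 'I_(ny M).

(* Cells are numbered from 0; [ordS] and [ord_pred] are the cyclic successor
   and predecessor, which encode the periodic boundary conditions. *)

Definition dx : R := (xmax M - xmin M) / (nx M)%:R.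
Definition dy : R := (ymax M - ymin M) / (ny M)%:R.

Definition xleft (i : Ix) : R := xmin M + i%:R * dx.
Definition xright (i : Ix) : R := xmin M + i.+1%:R * dx.
Definition ybot (j : Iy) : R := ymin M + j%:R * dy.
Definition ytop (j : Iy) : R := ymin M + j.+1%:R * dy.
Definition xcenter (i : Ix) : R := (xleft i + xright i) / 2.
Definition ycenter (j : Iy) : R := (ybot j + ytop j) / 2.

Definition Omega : set (R * R) :=
  `[xmin M, xmax M]%classic `*` `[ymin M, ymax M]%classic.
Definition cellx (i : Ix) : set R := `[xleft i, xright i]%classic.
Definition celly (j : Iy) : set R := `[ybot j, ytop j]%classic.
Definition cell (i : Ix) (j : Iy) : set (R * R) := cellx i `*` celly j.
Definition cell_boundary (i : Ix) (j : Iy) : set (R * R) :=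
  ([set xleft i; xright i] `*` celly j) `|`
  (cellx i `*` [set ybot j; ytop j]).

(* A function given cell by cell, [w i j x y]; on an interface the functions
   of the two adjacent cells give the two traces. *)
Definition cellfun : Type := Ix -> Iy -> R -> R -> R.

Definition int_x (i : Ix) (f : R -> R) : R :=
  \int[lebesgue_measure]_(x in cellx i) f x.
Definition int_y (j : Iy) (f : R -> R) : R :=
  \int[lebesgue_measure]_(y in celly j) f y.
Definition int_cell (i : Ix) (j : Iy) (f : R -> R -> R) : R :=
  \int[(lebesgue_measure \x lebesgue_measure)%E]_(p in cell i j) f p.1 p.2.
Definition cell_average (w : cellfun) (i : Ix) (j : Iy) : R :=
  (dx * dy)^-1 * int_cell i j (w i j).

(* Traces on the right side of cell (i, j).  The plus trace is taken at the
   left end of the next cell, which after periodic wrap-around is a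
   different abscissa. *)
Definition xminus (w : cellfun) i j y : R := w i j (xright i) y.
Definition xplus (w : cellfun) i j y : R := w (ordS i) j (xleft (ordS i)) y.
Definition xjump (w : cellfun) i j y : R := xplus w i j y - xminus w i j y.
Definition xavg (w : cellfun) i j y : R :=
  (xminus w i j y + xplus w i j y) / 2.

Definition yminus (w : cellfun) i j x : R := w i j x (ytop j).
Definition yplus (w : cellfun) i j x : R := w i (ordS j) x (ybot (ordS j)).
Definition yjump (w : cellfun) i j x : R := yplus w i j x - yminus w i j x.
Definition yavg (w : cellfun) i j x : R :=
  (yminus w i j x + yplus w i j x) / 2.

(* In {poly {poly R}} the outer variable is x and the inner one is y. *)
Definition dgfun : Type := Ix -> Iy -> {poly {poly R}}.

Definition in_Vh (k : nat) (v : dgfun) : Prop :=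
  forall i j, (size (v i j) <= k.+1)%N /\
              forall l : nat, (size ((v i j)`_l)%R <= k.+1)%N.

Definition ev (v : dgfun) : cellfun := fun i j x y => (v i j).[x%:P].[y].
Definition Dx (v : dgfun) : dgfun := fun i j => (v i j)^`().
Definition Dy (v : dgfun) : dgfun := fun i j => map_poly (@deriv R) (v i j).
Definition grad (v : dgfun) i j x y : 'cV[R]_2 :=
  vec2 (ev (Dx v) i j x y) (ev (Dy v) i j x y).

Definition oncells (f : R -> R -> R -> R) (u : dgfun) : cellfun :=
  fun i j x y => f x y (ev u i j x y).

Definition coef_values (c1 c2 : R) (f : R -> R -> R -> R) : set R :=
  [set f p.1.1 p.1.2 p.2 | p in Omega `*` `[c1, c2]%classic].

Definition measurable_coef (f : R -> R -> R -> R) : Prop :=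
  measurable_fun (Omega `*` [set: R]) (fun p : R * R * R => f p.1.1 p.1.2 p.2).

Section Scheme.
Variables (a b c : R -> R -> R -> R) (beta0 beta1 : R).

(* The components of the numerical gradient on the right side
   (resp. on the top side) of cell (i, j). *)
Definition xflux_dx (u : dgfun) i j y : R :=
  beta0 / dx * xjump (ev u) i j y + xavg (ev (Dx u)) i j y
  + beta1 * dx * xjump (ev (Dx (Dx u))) i j y.
Definition xflux_dy (u : dgfun) i j y : R := xavg (ev (Dy u)) i j y.

Definition yflux_dy (u : dgfun) i j x : R :=
  beta0 / dy * yjump (ev u) i j x + yavg (ev (Dy u)) i j x
  + beta1 * dy * yjump (ev (Dy (Dy u))) i j x.
Definition yflux_dx (u : dgfun) i j x : R := yavg (ev (Dx u)) i j x.

Definition Ah (u : dgfun) i j x y : 'M[R]_2 :=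
  sym2 (oncells a u i j x y) (oncells b u i j x y) (oncells c u i j x y).
Definition Ah_xavg (u : dgfun) i j y : 'M[R]_2 :=
  sym2 (xavg (oncells a u) i j y) (xavg (oncells b u) i j y)
       (xavg (oncells c u) i j y).
Definition Ah_yavg (u : dgfun) i j x : 'M[R]_2 :=
  sym2 (yavg (oncells a u) i j x) (yavg (oncells b u) i j x)
       (yavg (oncells c u) i j x).

Definition xgrad_flux (u : dgfun) i j y : 'cV[R]_2 :=
  vec2 (xflux_dx u i j y) (xflux_dy u i j y).
Definition ygrad_flux (u : dgfun) i j x : 'cV[R]_2 :=
  vec2 (yflux_dx u i j x) (yflux_dy u i j x).

(* The boundary integral over K_ij of {A} (numerical gradient) . nu v. *)
Definition bdry_flux (u v : dgfun) (i : Ix) (j : Iy) : R :=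
  int_y j (fun y => dot (Ah_xavg u i j y *m xgrad_flux u i j y) (vec2 1 0)
                    * ev v i j (xright i) y)
  + int_y j (fun y =>
      dot (Ah_xavg u (ord_pred i) j y *m xgrad_flux u (ord_pred i) j y)
          (vec2 (-1) 0)
      * ev v i j (xleft i) y)
  + int_x i (fun x => dot (Ah_yavg u i j x *m ygrad_flux u i j x) (vec2 0 1)
                      * ev v i j x (ytop j))
  + int_x i (fun x =>
      dot (Ah_yavg u i (ord_pred j) x *m ygrad_flux u i (ord_pred j) x)
          (vec2 0 (-1))
      * ev v i j x (ybot j)).

(* The boundary integral over K_ij of {A} (grad v) . nu (u - {u}), where v
   and u stand for their traces from inside K_ij. *)
Definition bdry_correction (u v : dgfun) (i : Ix) (j : Iy) : R :=
  int_y j (fun y =>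
      dot (Ah_xavg u i j y *m grad v i j (xright i) y) (vec2 1 0)
      * (ev u i j (xright i) y - xavg (ev u) i j y))
  + int_y j (fun y =>
      dot (Ah_xavg u (ord_pred i) j y *m grad v i j (xleft i) y) (vec2 (-1) 0)
      * (ev u i j (xleft i) y - xavg (ev u) (ord_pred i) j y))
  + int_x i (fun x =>
      dot (Ah_yavg u i j x *m grad v i j x (ytop j)) (vec2 0 1)
      * (ev u i j x (ytop j) - yavg (ev u) i j x))
  + int_x i (fun x =>
      dot (Ah_yavg u i (ord_pred j) x *m grad v i j x (ybot j)) (vec2 0 (-1))
      * (ev u i j x (ybot j) - yavg (ev u) i (ord_pred j) x)).

Definition weak_form (tau : R) (u unew v : dgfun) (i : Ix) (j : Iy) : Prop :=
  int_cell i j (fun x y => ev unew i j x y * ev v i j x y) =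
  int_cell i j (fun x y => ev u i j x y * ev v i j x y)
  - tau * int_cell i j
      (fun x y => dot (Ah u i j x y *m grad u i j x y) (grad v i j x y))
  + tau * bdry_flux u v i j + tau * bdry_correction u v i j.

Definition mu_x (tau : R) : R := tau / dx ^+ 2.
Definition mu_y (tau : R) : R := tau / dy ^+ 2.
Definition mu (tau : R) : R := mu_x tau + mu_y tau.

Definition H1 (tau : R) (u : dgfun) i j y : R :=
  dx^-1 * int_x i (fun x => ev u i j x y)
  + mu tau * dx
    * (xavg (oncells a u) i j y * xflux_dx u i j y
       - xavg (oncells a u) (ord_pred i) j y * xflux_dx u (ord_pred i) j y).

Definition H2 (tau : R) (u : dgfun) i j x : R :=
  dy^-1 * int_y j (fun y => ev u i j x y)
  + mu tau * dy
    * (yavg (oncells b u) i j x * yflux_dy u i j x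
       - yavg (oncells b u) i (ord_pred j) x * yflux_dy u i (ord_pred j) x).

Definition mixed_term (tau : R) (u : dgfun) (i : Ix) (j : Iy) : R :=
  tau / (dx * dy) *
  ((int_y j (fun y => xavg (oncells c u) i j y * xavg (ev (Dy u)) i j y)
    - int_y j (fun y => xavg (oncells c u) (ord_pred i) j y
                        * xavg (ev (Dy u)) (ord_pred i) j y))
   + (int_x i (fun x => yavg (oncells c u) i j x * yavg (ev (Dx u)) i j x)
      - int_x i (fun x => yavg (oncells c u) i (ord_pred j) x
                          * yavg (ev (Dx u)) i (ord_pred j) x))).

Section Quadrature.
Variables (L : nat) (node weight : 'I_L -> R).

Definition xhat (i : Ix) (s : 'I_L) : R := xcenter i + dx / 2 * node s.
Definition yhat (j : Iy) (s : 'I_L) : R := ycenter j + dy / 2 * node s.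

Definition average_update (tau : R) (u : dgfun) (i : Ix) (j : Iy) : R :=
  mu_x tau / mu tau * (\sum_s weight s * H1 tau u i j (yhat j s))
  + mu_y tau / mu tau * (\sum_s weight s * H2 tau u i j (xhat i s))
  + mixed_term tau u i j.

(* On each cell a test function is a constant plus a function of mean zero.
   The equation tested with constants (the cell average) is the one obtained
   by quadrature, instead of the exact one; the others are unchanged. *)
Definition ddg_step (k : nat) (tau : R) (u unew : dgfun) : Prop :=
  [/\ in_Vh k unew,
      forall v, in_Vh k v -> forall i j,
        cell_average (ev v) i j = 0 -> weak_form tau u unew v i j &
      forall i j, cell_average (ev unew) i j = average_update tau u i j].

Definition test_set (gammax gammay : R) (i : Ix) (j : Iy) : set (R * R) :=
  ([set xcenter i + dx / 2 * t | t in [set -1; gammax; 1]]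
     `*` [set yhat j s | s in [set: 'I_L]])
  `|` ([set xhat i s | s in [set: 'I_L]]
     `*` [set ycenter j + dy / 2 * t | t in [set -1; gammay; 1]]).

End Quadrature.

End Scheme.

End Mesh.

Section Bounds.
Variable R : realType.
Local Open Scope ereal_scope.

(* Quotients are taken in \bar R, where r / 0 = +oo for r > 0
   and 0 / 0 = 0. *)

Definition beta0_bound (L : nat) (kappa cnorm abmin gamma : R) : \bar R :=
  1 + (2 * kappa * cnorm * (L * L.-1)%:R)%:E / ((1 - gamma) * abmin)%:E.

Definition mu0_bound (L : nat) (kappa cnorm abmax beta0 beta1 gamma : R)
    : \bar R :=
  mine ((1 - 3 * gamma)%:E /
        (6 * abmax * (beta0 + (8 * beta1 - 2) / (1 + gamma)) * (1 - gamma)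
         + 12 * kappa * cnorm * (L * L.-1)%:R)%:E)
       (1 / (6 * abmax * (1 - 4 * beta1))%:E).

End Bounds.

(* Main.v *)
Require Import Defs.
From HB Require Import structures.
From mathcomp Require Import all_boot all_order all_algebra.
From mathcomp Require Import all_classical all_reals all_analysis.
From mathcomp Require Import measurable_realfun.
From mathcomp Require Import ring lra zify.

(** The new average of a cell is an affine combination of values of u at the
    test points, plus the term coming from the off-diagonal coefficient c.
    Two facts keep it in [c1, c2].

    - In each coordinate direction the one-dimensional update H1 (or H2) is a
      combination of nine point values, three in the cell and three in each
      neighbour: a quadratic polynomial, its mean and its numerical flux are
      determined by the values at -1, g and 1.  The conditions on beta0, beta1
      and mu make all nine coefficients nonnegative; moreover the
      coefficients of the four values next to the two interfaces are at least mu * S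
      with S = 2 kappa |c| L (L - 1) / (1 - gamma).  For the two outer ones
      this is the lower bound on beta0, for the two inner ones it is the first
      entry of mu0; the second entry of mu0 is nonnegativity of the
      coefficient of the interior value ([interval_update_ge]).

    - The mixed term only involves tangential derivatives of u on the cell
      edges.  On an edge u is a quadratic polynomial q with q >= c1 at the
      Gauss-Lobatto nodes, and the derivative of such a polynomial is
      controlled by L (L - 1) times the quadrature of q - c1
      ([gauss_lobatto_derivative_bound]).  This quadrature is a sum of the
      edge values for which the reserve mu * S was kept, so after weighting by
      mu_x / mu and mu_y / mu the reserve absorbs the mixed term
      ([average_update_ge]).

    The upper bound is the lower bound for c2 - u.  Since a, b and c are
    evaluated at u itself, u cannot simply be replaced by its negative;
    instead everything is stated for the affine function sg * (u - c0) of the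
    point values, and used with (sg, c0) = (1, c1) and (-1, c2). *)

Set Implicit Arguments.
Unset Strict Implicit.
Unset Printing Implicit Defensive.

Import Order.TTheory GRing.Theory Num.Theory.
Import numFieldNormedType.Exports.

Local Open Scope classical_set_scope.
Local Open Scope ring_scope.

(** * Integrals of polynomials *)

Section Integral.
Variable R : realType.

Lemma continuous_within_horner (p : {poly R}) (A : set R) :
  {within A, continuous (horner p)}.
Proof.
apply: continuous_subspaceT => x; apply: differentiable_continuous.
by apply/derivable1_diffP; have [] := is_derive_poly p x.
Qed.

Lemma Rintegral_deriv (P : {poly R}) (a b : R) : a < b ->
  \int[lebesgue_measure]_(x in `[a, b]) P^`().[x] = P.[b] - P.[a].
Proof.
move=> ab; rewrite /Rintegral.
rewrite (@continuous_FTC2 _ (horner P^`()) (horner P) _ _ ab) //.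
- exact: continuous_within_horner.
- have cP : {within `[a, b], continuous (horner P)}.
    exact: continuous_within_horner.
  have [_ ra lb] := (continuous_within_itvP _ ab).1 cP.
  by split.
- by move=> x _; rewrite derivE.
Qed.

Lemma Rintegral_horner (p : {poly R}) n (a b : R) : (size p <= n)%N -> a < b ->
  \int[lebesgue_measure]_(x in `[a, b]) p.[x]
  = \sum_(i < n) p`_i / i.+1%:R * (b ^+ i.+1 - a ^+ i.+1).
Proof.
move=> sp ab.
pose P := \poly_(i < n.+1) (p`_i.-1 / i%:R).
have pE : p = P^`() :> {poly R}.
  apply/polyP => i; rewrite coef_deriv coef_poly ltnS.
  case: ltnP => [_|ni]; first by rewrite -[RHS]mulr_natr divfK // pnatr_eq0.
  by rewrite mul0rn nth_default // (leq_trans sp).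
rewrite [in LHS]pE Rintegral_deriv // !horner_poly -sumrB big_ord_recl /= !expr0.
rewrite subrr add0r; apply: eq_bigr => i _.
by rewrite /= -mulrBr.
Qed.

End Integral.

(** * The Gauss-Lobatto rule *)

Section GaussLobattoRule.
Variables (R : realType) (L : nat) (node weight : 'I_L -> R).
Hypothesis hGL : gauss_lobatto node weight.
Hypothesis L_ge3 : (3 <= L)%N.

Let Lgt0 : (0 < L)%N. Proof. exact: leq_trans L_ge3. Qed.
Let Lpred : (L.-1 < L)%N. Proof. by rewrite prednK. Qed.
Let first_node : 'I_L := Ordinal Lgt0.
Let last_node : 'I_L := Ordinal Lpred.

Lemma node_first : node first_node = -1.
Proof. by have [_ + _ _] := hGL; apply. Qed.

Lemma node_last : node last_node = 1.
Proof. by have [_ _ + _] := hGL; apply. Qed.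

Lemma node_inj : injective node.
Proof.
have [mono _ _ _] := hGL => s t e; apply/val_inj => /=.
by case: (ltngtP s t) => // /mono; rewrite e ltxx.
Qed.

Lemma node_itv s : -1 <= node s <= 1.
Proof.
have [mono _ _ _] := hGL.
have monoW (i j : 'I_L) : (i <= j)%N -> node i <= node j.
  by rewrite leq_eqVlt => /orP[/eqP/val_inj->//|/mono/ltW].
rewrite -node_first -node_last !monoW //=.
by rewrite -ltnS prednK.
Qed.

(** A polynomial that is nonnegative on [-1, 1] and vanishes there only at the
    node s.  At an end point a simple root suffices, which saves the degree
    that keeps the product of L - 1 factors within the exactness range. *)
Definition node_factor (s : 'I_L) : {poly R} :=
  if s == first_node then 1 + 'X else if s == last_node then 1 - 'X
  else ('X - (node s)%:P) ^+ 2.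

Lemma node_factor_ge0 s t : -1 <= t <= 1 -> 0 <= (node_factor s).[t].
Proof.
move=> /andP[t0 t1]; rewrite /node_factor; do 2?case: ifP => _.
- by rewrite !hornerE; lra.
- by rewrite !hornerE; lra.
- by rewrite horner_exp sqr_ge0.
Qed.

Lemma node_factor_eq0 s t : ((node_factor s).[node t] == 0) = (t == s).
Proof.
rewrite /node_factor; have [->|nf] := eqVneq s first_node.
  rewrite !hornerE addrC addr_eq0 -node_first.
  by apply/eqP/eqP => [/node_inj|->].
have [->|nl] := eqVneq s last_node.
  rewrite !hornerE subr_eq0 -node_last.
  by apply/eqP/eqP => [/node_inj|->].
rewrite horner_exp sqrf_eq0 !hornerE subr_eq0.
by apply/eqP/eqP => [/node_inj|->].
Qed.

Lemma size_node_factor s :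
  (size (node_factor s) <= 3)%N /\
  (s == first_node \/ s == last_node -> (size (node_factor s) <= 2)%N).
Proof.
have s1 : (size (1 + 'X : {poly R})%R <= 2)%N.
  by rewrite addrC -[1]/(1%:P) size_XaddC.
have s2 : (size (1 - 'X : {poly R})%R <= 2)%N.
  by rewrite -size_polyN opprB -[1]/(1%:P) size_XsubC.
rewrite /node_factor; have [_|nf] := eqVneq s first_node.
  by split=> [|_]; rewrite ?(leq_trans s1).
have [_|nl] := eqVneq s last_node.
  by split=> [|_]; rewrite ?(leq_trans s2).
by split=> [|[]//]; rewrite size_exp_XsubC.
Qed.

Lemma size_other_factors s :
  (size (\prod_(t | t != s) node_factor t)%R <= 2 * L - 2)%N.
Proof.
have [e se eE] : exists2 e, e != s & e == first_node \/ e == last_node.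
  have [->|sf] := eqVneq s first_node; last by exists first_node; rewrite 1?eq_sym//; left.
  exists last_node; last by right.
  by apply/eqP => /(congr1 val)/= E; move: L_ge3; rewrite -(prednK Lgt0) E.
rewrite (bigD1 e) //=; apply: leq_trans (size_polyMleq _ _) _.
have [_ /(_ eE) s2] := size_node_factor e.
have sp : (size (\prod_(t | (t != s) && (t != e)) node_factor t)%R <= 2 * (L - 2) + 1)%N.
  apply: leq_trans (size_poly_prod_leq _ _) _.
  have cE : #|[pred t | (t != s) && (t != e)]| = (L - 2)%N.
    rewrite -[in RHS](card_ord L) -(cardC [pred t | (t != s) && (t != e)]).
    rewrite addnC -addnBAC.
      rewrite (_ : #|[predC [pred t | _]]| = 2) ?subnn //.
      rewrite (eq_card (B := pred2 s e)) ?card2 1?eq_sym ?se // => t.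
      by rewrite !inE negb_and !negbK.
    rewrite (eq_card (B := pred2 s e)) ?card2 1?eq_sym ?se // => t.
    by rewrite !inE negb_and !negbK.
  rewrite cE leq_subLR -addn1 addnA leq_add2r.
  apply: (@leq_trans (\sum_(t | (t != s) && (t != e)) 3)).
    by apply: leq_sum => t _; case: (size_node_factor t).
  by rewrite sum_nat_const -[X in (X * _)%N]/#|[pred t | (t != s) && (t != e)]| cE; lia.
apply: (@leq_trans (2 + (2 * (L - 2) + 1)).-1); last by lia.
by rewrite -!subn1 leq_sub2r // leq_add.
Qed.

(** Integrate the product of the factors of all other nodes: the rule is exact
    for it and only the term of the node s survives. *)
Lemma weight_ge0 s : 0 <= weight s.
Proof.
have [_ _ _ exact] := hGL.
have := exact _ (size_other_factors s).
rewrite (bigD1 s) //= [X in _ + X = _]big1 ?addr0 => [wE|t ts]; last first.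
  apply/eqP; rewrite mulf_eq0 horner_prod; apply/orP; right.
  by apply/prodf_eq0; exists t => //; rewrite node_factor_eq0.
have pge0 t : -1 <= t <= 1 -> 0 <= (\prod_(t | t != s) node_factor t).[t].
  by move=> t1; rewrite horner_prod; apply: prodr_ge0 => i _; exact: node_factor_ge0.
have p_gt0 : 0 < (\prod_(t | t != s) node_factor t).[node s].
  rewrite lt_neqAle pge0 ?node_itv // andbT eq_sym horner_prod.
  by apply/prodf_neq0 => t ts; rewrite node_factor_eq0 eq_sym.
rewrite -(pmulr_lge0 _ p_gt0) wE mulr_ge0 ?invr_ge0 //.
apply: Rintegral_ge0 => t /=; rewrite in_itv /=; exact: pge0.
Qed.

(** Stated for coefficient lists so that a polynomial such as (1 - t) q(t) can
    be fed to the rule by writing down its coefficients: [horner_rec] then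
    computes. *)
Lemma gauss_lobatto_moments (l : seq R) :
  (size l <= 2 * L - 2)%N -> (size l <= 5)%N ->
  \sum_s weight s * horner_rec l (node s) = l`_0 + l`_2 / 3 + l`_4 / 5.
Proof.
move=> sL s5; have [_ _ _ exact] := hGL.
have sl := size_Poly l.
rewrite (eq_bigr (fun s => weight s * (Poly l).[node s])); last first.
  by move=> s _; rewrite horner_Poly.
rewrite exact ?(leq_trans sl) // (Rintegral_horner (leq_trans sl s5)); last by lra.
rewrite !big_ord_recl big_ord0 /= !coef_Poly /bump /=.
by field.
Qed.

Lemma weighted_sum_ge0 (f : 'I_L -> R) :
  (forall s, 0 <= f s) -> 0 <= \sum_s weight s * f s.
Proof. by move=> f_ge0; apply: sumr_ge0 => s _; rewrite mulr_ge0 ?weight_ge0. Qed.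

(** The rule integrates t (1 - t^2) to 0 and 1 - t^2 to 2/3, and the end points
    contribute to neither. *)
Lemma middle_node : L = 3 -> exists s, node s = 0.
Proof.
move=> L3; have L1 : (1 < L)%N by rewrite L3.
pose mid : 'I_L := Ordinal L1; exists mid.
have others s : s != mid -> node s = -1 \/ node s = 1.
  have [_ n0 n1 _] := hGL.
  rewrite -val_eqE /= => s1; have s3 := ltn_ord s.
  have [s0|s0] : nat_of_ord s = 0%N \/ nat_of_ord s = L.-1 by lia.
    by left; exact: n0.
  by right; exact: n1.
have onlymid (f : R -> R) : f (-1) = 0 -> f 1 = 0 ->
    \sum_s weight s * f (node s) = weight mid * f (node mid).
  move=> f0 f1; rewrite (bigD1 mid) //= big1 ?addr0 // => s /others[] ->.
    by rewrite f0 mulr0.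
  by rewrite f1 mulr0.
have L4 : (3 <= 2 * L - 2)%N /\ (4 <= 2 * L - 2)%N by lia.
have m1 := @gauss_lobatto_moments [:: 0; 1; 0; -1] L4.2 isT.
have m0 := @gauss_lobatto_moments [:: 1; 0; -1] L4.1 isT.
move: m0 m1; rewrite !(onlymid (horner_rec _)) /=; try by ring.
set w := weight mid; set n := node mid => m0 m1.
have e0 : w * (1 - n ^+ 2) = 2 / 3.
  by move: m0; rewrite mul0r; lra.
have e1 : n * (w * (1 - n ^+ 2)) = 0.
  by move: m1; rewrite !mul0r !addr0 => <-; ring.
by move: e1; rewrite e0; lra.
Qed.

(** Write q = q0 + q1 t + q2 t^2 and let Q be its quadrature, q0 + q2 / 3.  As
    the weights are nonnegative, the rule is nonnegative on the products of q
    with functions that are nonnegative on [-1, 1] as long as it is exact for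
    them: 1 - t and 1 + t give |q1| <= 3 Q, the two end points give
    - q2 <= 3/2 Q.  An upper bound for q2 needs more than these.  With four
    nodes or more the factor 1 - t^2 is available and gives q2 <= 15/2 Q; with
    three nodes the value at the node 0 gives q2 <= 3 Q.  The bound fails if
    one only knows that q is nonnegative at the end points. *)
Lemma gauss_lobatto_derivative_bound (q : {poly R}) t :
  (size q <= 3)%N -> (forall s, 0 <= q.[node s]) -> -1 <= t <= 1 ->
  `|q^`().[t]| <= 2 * (L * L.-1)%:R * \sum_s weight s * q.[node s].
Proof.
move=> sq qge0 /andP[t0 t1].
have qE x : q.[x] = q`_0 + q`_1 * x + q`_2 * x ^+ 2.
  by rewrite (horner_coef_wide _ sq) !big_ord_recr big_ord0 /=; ring.
have dqE x : q^`().[x] = q`_1 + 2 * q`_2 * x.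
  have sd : (size q^`() <= 2)%N by rewrite (leq_trans (size_poly _ _)) // -subn1 leq_subLR.
  rewrite (horner_coef_wide _ sd) !big_ord_recr big_ord0 /= !coef_deriv.
  by ring.
rewrite dqE; move: {dqE} (q`_0) (q`_1) (q`_2) qE => q0 q1 q2 qE.
have L4 : (3 <= 2 * L - 2)%N /\ (4 <= 2 * L - 2)%N by lia.
(* The four quadratures below are those of q, (1 - t) q, (1 + t) q and,
   further down, (1 - t^2) q. *)
have hQ : \sum_s weight s * q.[node s] = q0 + q2 / 3.
  have /= := @gauss_lobatto_moments [:: q0; q1; q2] L4.1 isT.
  rewrite mul0r addr0 => <-; apply: eq_bigr => s _; rewrite qE; ring.
have hm : 0 <= q0 + (q2 - q1) / 3.
  have /= := @gauss_lobatto_moments [:: q0; q1 - q0; q2 - q1; - q2] L4.2 isT.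
  rewrite mul0r addr0 => <-; apply: weighted_sum_ge0 => s.
  rewrite [leRHS](_ : _ = (1 - node s) * q.[node s]); last by rewrite qE; ring.
  by rewrite mulr_ge0 // subr_ge0; have /andP[] := node_itv s.
have hp : 0 <= q0 + (q2 + q1) / 3.
  have /= := @gauss_lobatto_moments [:: q0; q1 + q0; q2 + q1; q2] L4.2 isT.
  rewrite mul0r addr0 => <-; apply: weighted_sum_ge0 => s.
  rewrite [leRHS](_ : _ = (1 + node s) * q.[node s]); last by rewrite qE; ring.
  by rewrite mulr_ge0 // -lerBlDl sub0r; have /andP[] := node_itv s.
have he : 0 <= q0 + q2.
  have := qge0 first_node; have := qge0 last_node.
  by rewrite node_first node_last !qE; lra.
set Q := \sum_s _ in hQ *.
have Q0 : 0 <= Q by rewrite hQ; lra.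
have b1 : `|q1| <= 3 * Q by rewrite ler_norml hQ; apply/andP; split; lra.
suff b2 : `|q2| <= ((L * L.-1)%:R - 3 / 2) * Q.
  apply: le_trans (ler_normD _ _) _; rewrite !normrM (ger0_norm (ler0n _ 2)).
  have : `|t| <= 1 by rewrite ler_norml t0 t1.
  have := normr_ge0 q2; nra.
have [L3|L4'] : (L = 3 \/ 3 < L)%N by lia.
  have [s s0] := middle_node L3.
  have := qge0 s; rewrite s0 qE L3 (_ : (3 * 3.-1)%:R = 6) // => hz.
  by rewrite ler_norml hQ; apply/andP; split; lra.
have hc : 0 <= q0 + (q2 - q0) / 3 - q2 / 5.
  have /= := @gauss_lobatto_moments [:: q0; q1; q2 - q0; - q1; - q2] _ isT.
  rewrite mulNr => <-; last by lia.
  apply: weighted_sum_ge0 => s.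
  rewrite [leRHS](_ : _ = (1 - node s ^+ 2) * q.[node s]); last by rewrite qE; ring.
  by rewrite mulr_ge0 // subr_ge0; have /andP[? ?] := node_itv s; nra.
have L12 : 12 <= (L * L.-1)%:R :> R.
  by rewrite (ler_nat _ 12) (@leq_mul 4 3) // -ltnS prednK.
have b2 : `|q2| <= 15 / 2 * Q by rewrite ler_norml hQ; apply/andP; split; lra.
apply: le_trans b2 _; rewrite ler_wpM2r //; lra.
Qed.

End GaussLobattoRule.

(** * The one-dimensional update in terms of point values *)

Section OneDimension.
Variable R : realType.
Implicit Types (p q : {poly R}) (g h xl xr : R).

(** The leading coefficient, in the reference variable, of the quadratic with
    values m, c and e at -1, g and 1. *)
Definition second_difference g m c e : R :=
  m / (2 * (1 + g)) - c / (1 - g ^+ 2) + e / (2 * (1 - g)).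

(** The numerical derivative at an interface, times the mesh size: the primed
    values are those of the cell on the right.  The averaged derivatives
    contribute the difference of chords and of second differences; the latter
    merges with the beta1 term, whence the factor 8 b1 - 2. *)
Definition value_flux b0 b1 g m c e m' c' e' : R :=
  b0 * (m' - e) + (e - m) / 2 + (e' - m') / 2
  + (8 * b1 - 2) * (second_difference g m' c' e' - second_difference g m c e).

(** The interpolatory quadrature rule with nodes -1, g and 1.  The end weights
    (1 + 3 g) / (6 (1 + g)) and (1 - 3 g) / (6 (1 - g)) are written so that
    they are visibly decreasing in the reciprocals of 1 + g and 1 - g. *)
Definition value_average g m c e : R :=
  (3 - 2 / (1 + g)) / 6 * m + 2 / (3 * (1 - g ^+ 2)) * c
  + (3 - 2 / (1 - g)) / 6 * e.

Lemma horner_quadratic p x :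
  (size p <= 3)%N -> p.[x] = p`_0 + p`_1 * x + p`_2 * x ^+ 2.
Proof.
move=> sp.
by rewrite (horner_coef_wide _ sp) !big_ord_recr big_ord0 /=; ring.
Qed.

Lemma horner_deriv_quadratic p x :
  (size p <= 3)%N -> p^`().[x] = p`_1 + 2 * p`_2 * x.
Proof.
move=> sp; have sd : (size p^`() <= 2)%N.
  by rewrite (leq_trans (size_poly _ _)) // -subn1 leq_subLR.
rewrite (horner_coef_wide _ sd) !big_ord_recr big_ord0 /= !coef_deriv.
by ring.
Qed.

Lemma horner_deriv2_quadratic p x :
  (size p <= 3)%N -> p^`()^`().[x] = 2 * p`_2.
Proof.
move=> sp; have sd : (size p^`()^`() <= 1)%N.
  rewrite (leq_trans (size_poly _ _)) // -subn1 leq_subLR.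
  by rewrite (leq_trans (size_poly _ _)) // -subn1 leq_subLR.
rewrite (horner_coef_wide _ sd) !big_ord_recr big_ord0 /= !coef_deriv.
by ring.
Qed.

Lemma interval_average p g h xl : (size p <= 3)%N -> 0 < h -> -1 < g < 1 ->
  h^-1 * \int[lebesgue_measure]_(x in `[xl, xl + h]) p.[x] =
  value_average g p.[xl] p.[xl + h / 2 * (1 + g)] p.[xl + h].
Proof.
move=> sp h0 /andP[g0 g1]; rewrite (Rintegral_horner sp) ?ltrDl //.
rewrite !(horner_quadratic _ sp) /value_average !big_ord_recr big_ord0 /=.
field; do ?[apply/andP; split]; try by apply/eqP; lra.
by rewrite lt0r_neq0 //; nra.
Qed.

Definition interface_derivative b0 b1 h p q x x' : R :=
  b0 / h * (q.[x'] - p.[x]) + (p^`().[x] + q^`().[x']) / 2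
  + b1 * h * (q^`()^`().[x'] - p^`()^`().[x]).

Lemma interface_derivativeE b0 b1 p q g h xl xl' :
  (size p <= 3)%N -> (size q <= 3)%N -> 0 < h -> -1 < g < 1 ->
  interface_derivative b0 b1 h p q (xl + h) xl' =
  h^-1 * value_flux b0 b1 g
    p.[xl] p.[xl + h / 2 * (1 + g)] p.[xl + h]
    q.[xl'] q.[xl' + h / 2 * (1 + g)] q.[xl' + h].
Proof.
move=> sp sq h0 /andP[g0 g1].
rewrite /interface_derivative !(horner_quadratic _ sp) !(horner_quadratic _ sq).
rewrite !(horner_deriv_quadratic _ sp) !(horner_deriv_quadratic _ sq).
rewrite !(horner_deriv2_quadratic _ sp) !(horner_deriv2_quadratic _ sq).
rewrite /value_flux /second_difference.
field; do ?[apply/andP; split]; try by apply/eqP; lra.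
by rewrite lt0r_neq0 //; nra.
Qed.

(** S is the share of the four values adjacent to the interfaces, in units of
    mu, that is set aside to absorb the mixed derivatives. *)
Record flux_condition (b0 b1 gam amin amax mu S : R) : Prop := FluxCondition {
  gamma_ge0 : 0 <= gam;
  gamma_lt1 : gam < 1;
  gamma_le_beta1 : gam <= 8 * b1 - 1;
  beta1_le : b1 <= 4^-1;
  beta0_ge1 : 1 <= b0;
  amin_ge0 : 0 <= amin;
  mu_ge0 : 0 <= mu;
  neighbour_reserve : S <= amin * (b0 - 1);
  endpoint_reserve : mu * (amax * (b0 + (8 * b1 - 2) / (1 + gam)) + S)
                     <= (1 - 3 * gam) / (6 * (1 - gam));
  midpoint_reserve : mu * (6 * amax * (1 - 4 * b1)) <= 1 }.

(** The coefficient of an end value of the cell itself, with s = 1 / (1 - g) at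
    the right end and s = 1 / (1 + g) at the left end.  The quadrature weight is
smallest and the flux term largest at the two extremes of s, namely
    1 / (1 - gam) and 1 / (1 + gam) respectively, and [endpoint_reserve] combines
    both. *)
Lemma endpoint_coef_ge0 (b0 b1 gam amin amax mu S s ar al : R) :
  flux_condition b0 b1 gam amin amax mu S ->
  (1 + gam)^-1 <= s <= (1 - gam)^-1 -> 0 <= ar <= amax -> 0 <= al <= amax ->
  0 <= (3 - 2 * s) / 6 - mu * (ar * (b0 - 1 / 2 - (2 - 8 * b1) * s / 2)
                               + al * (1 / 2 - (2 - 8 * b1) * s / 2)) - mu * S.
Proof.
move=> [gam_ge0 gam_lt1 gam_le b1_le b0_ge1 _ mu_ge0 _ mu_end _].
move=> /andP[s0 s1] /andP[r0 r1] /andP[l0 l1].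
have k0 : 0 <= 2 - 8 * b1 by lra.
have ks : (2 - 8 * b1) * s <= 1.
  rewrite -[leRHS](@divff _ (1 - gam)); last by apply/eqP; lra.
  have sge0 : 0 <= s by apply: le_trans s0; rewrite invr_ge0; lra.
  by apply: ler_pM => //; lra.
have hl : (1 - 3 * gam) / (6 * (1 - gam)) <= (3 - 2 * s) / 6.
  have -> : (1 - 3 * gam) / (6 * (1 - gam)) = (3 - 2 * (1 - gam)^-1) / 6.
    by field; apply/eqP; lra.
  by lra.
suff : ar * (b0 - 1 / 2 - (2 - 8 * b1) * s / 2) + al * (1 / 2 - (2 - 8 * b1) * s / 2)
    <= amax * (b0 + (8 * b1 - 2) / (1 + gam)).
  by move=> /(ler_wpM2l mu_ge0); nra.
have h1 : ar * (b0 - 1 / 2 - (2 - 8 * b1) * s / 2)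
    <= amax * (b0 - 1 / 2 - (2 - 8 * b1) * s / 2).
  by apply: ler_wpM2r => //; lra.
have h2 : al * (1 / 2 - (2 - 8 * b1) * s / 2) <= amax * (1 / 2 - (2 - 8 * b1) * s / 2).
  by apply: ler_wpM2r => //; lra.
apply: le_trans (lerD h1 h2) _; rewrite -mulrDr; apply: ler_wpM2l; first lra.
have := ler_wpM2l k0 s0; lra.
Qed.

(** The nine values are those of the cell, of the right neighbour (primed) and
    of the left one (doubly primed).  Reflection of the cell exchanges r and s,
    ar and al, so the coefficients come in mirror pairs. *)
Lemma interval_update_ge (b0 b1 gam amin amax mu S g ar al
    m c e m' c' e' m'' c'' e'' : R) :
  flux_condition b0 b1 gam amin amax mu S ->
  `|g| <= gam -> amin <= ar <= amax -> amin <= al <= amax ->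
  0 <= m -> 0 <= c -> 0 <= e -> 0 <= m' -> 0 <= c' -> 0 <= e' ->
  0 <= m'' -> 0 <= c'' -> 0 <= e'' ->
  mu * S * (m + e + m' + e'') <=
  value_average g m c e
  + mu * (ar * value_flux b0 b1 g m c e m' c' e'
          - al * value_flux b0 b1 g m'' c'' e'' m c e).
Proof.
move=> F; have [gam_ge0 gam_lt1 gam_le b1_le b0_ge1 amin_ge0 mu_ge0 S_le _ mu_mid] := F.
rewrite ler_norml => /andP[g0 g1] /andP[ar0 ar1] /andP[al0 al1].
move=> m0 c0 e0 m'0 c'0 e'0 m''0 c''0 e''0.
set r := (1 + g)^-1; set s := (1 - g)^-1; set k := 2 - 8 * b1.
have k0 : 0 <= k by rewrite /k; lra.
have r0 : (1 + gam)^-1 <= r <= (1 - gam)^-1.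
  by rewrite /r !lef_pV2 ?posrE; try lra; apply/andP; split; lra.
have s0 : (1 + gam)^-1 <= s <= (1 - gam)^-1.
  by rewrite /s !lef_pV2 ?posrE; try lra; apply/andP; split; lra.
have rge0 : 0 <= r by rewrite invr_ge0; lra.
have sge0 : 0 <= s by rewrite invr_ge0; lra.
have kle1 t : t <= (1 - gam)^-1 -> 0 <= t -> k * t <= 1.
  move=> t1 t0; rewrite -[leRHS](@divff _ (1 - gam)); last by apply/eqP; lra.
  by apply: ler_pM => //; rewrite /k; lra.
have kr : k * r <= 1 by apply: kle1 => //; lra.
have ks : k * s <= 1 by apply: kle1 => //; lra.
have Ar : 0 <= ar <= amax by apply/andP; split; lra.
have Al : 0 <= al <= amax by apply/andP; split; lra.
have Ce := endpoint_coef_ge0 F s0 Ar Al.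
have Cm := endpoint_coef_ge0 F r0 Al Ar.
rewrite -/k in Ce Cm.
(* The near end of a neighbour: k t <= 1, which is what gam <= 8 b1 - 1
   provides, leaves at least b0 - 1 of the coefficient. *)
have nb a t : amin <= a -> k * t <= 1 -> S <= a * (b0 - 1 / 2 - k * t / 2).
  move=> ha ht; apply: le_trans S_le _; apply: ler_pM => //; lra.
have Cm' := nb _ _ ar0 kr; have Ce'' := nb _ _ al0 ks.
have Cc : 0 <= 2 / 3 * (r * s) - mu * ((ar + al) * (k * (r * s))).
  have rs : 0 <= r * s by rewrite mulr_ge0.
  have h : mu * ((ar + al) * k) <= 2 / 3.
    have : (ar + al) * k <= 2 * amax * k by apply: ler_wpM2r => //; lra.
    by move=> /(ler_wpM2l mu_ge0); rewrite /k in mu_mid *; lra.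
  have := ler_wpM2r rs h; lra.
have nonneg a t v : 0 <= a -> k * t <= 1 -> 0 <= v -> 0 <= a * (1 / 2 - k * t / 2) * v.
  by move=> ? ? ?; rewrite !mulr_ge0 //; lra.
(* The difference of both sides, sorted by the nine values. *)
rewrite -subr_ge0.
have -> : (value_average g m c e
  + mu * (ar * value_flux b0 b1 g m c e m' c' e'
          - al * value_flux b0 b1 g m'' c'' e'' m c e)) - mu * S * (m + e + m' + e'')
 = ((3 - 2 * s) / 6 - mu * (ar * (b0 - 1 / 2 - k * s / 2)
                               + al * (1 / 2 - k * s / 2)) - mu * S) * e
 + ((3 - 2 * r) / 6 - mu * (al * (b0 - 1 / 2 - k * r / 2)
                               + ar * (1 / 2 - k * r / 2)) - mu * S) * m
 + (2 / 3 * (r * s) - mu * ((ar + al) * (k * (r * s)))) * c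
 + mu * ((ar * (b0 - 1 / 2 - k * r / 2) - S) * m'
 + (al * (b0 - 1 / 2 - k * s / 2) - S) * e''
 + ar * (1 / 2 - k * s / 2) * e' + al * (1 / 2 - k * r / 2) * m''
 + ar * (k * (r * s)) * c' + al * (k * (r * s)) * c'').
  rewrite /value_average /value_flux /second_difference /r /s /k.
  field; do ?[apply/andP; split]; try by apply/eqP; lra.
  by rewrite lt0r_neq0 //; nra.
have [Ar0 _] := andP Ar; have [Al0 _] := andP Al.
rewrite -subr_ge0 in Cm'; rewrite -subr_ge0 in Ce''.
have krs : 0 <= k * (r * s) by rewrite !mulr_ge0.
repeat apply: addr_ge0; try by apply: mulr_ge0.
apply: mulr_ge0 => //; repeat apply: addr_ge0; try by apply: mulr_ge0.
- exact: nonneg.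
- exact: nonneg.
- by rewrite !mulr_ge0.
- by rewrite !mulr_ge0.
Qed.

(** The affine function sg * (v - c0) stands for v - c1 or for c2 - v. *)
Definition test_ge0 g h sg c0 p xl : Prop :=
  forall t, [\/ t = -1, t = g | t = 1] ->
    0 <= sg * (p.[xl + h / 2 * (1 + t)] - c0).

(** Both sides of [interval_update_ge] are affine in the nine values and the
    update reproduces constants, so the lemma may be applied to
    sg * (v - c0). *)
Lemma interval_step_ge (b0 b1 gam amin amax mu S g ar al sg c0 h xl xl' xl'' : R)
    (p q r : {poly R}) :
  flux_condition b0 b1 gam amin amax mu S ->
  (size p <= 3)%N -> (size q <= 3)%N -> (size r <= 3)%N -> 0 < h ->
  `|g| <= gam -> amin <= ar <= amax -> amin <= al <= amax ->
  test_ge0 g h sg c0 p xl -> test_ge0 g h sg c0 q xl' ->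
  test_ge0 g h sg c0 r xl'' ->
  mu * S * (sg * (p.[xl] - c0) + sg * (p.[xl + h] - c0)
            + (sg * (q.[xl'] - c0) + sg * (r.[xl'' + h] - c0))) <=
  sg * (h^-1 * \int[lebesgue_measure]_(x in `[xl, xl + h]) p.[x]
        + mu * h * (ar * interface_derivative b0 b1 h p q (xl + h) xl'
                    - al * interface_derivative b0 b1 h r p (xl'' + h) xl) - c0).
Proof.
move=> F sp sq sr h0 hg har hal p0 q0 r0.
have [gam_ge0 gam_lt1 _ _ _ _ _ _ _ _] := F.
have g1 : -1 < g < 1.
  by move: hg; rewrite ler_norml => /andP[? ?]; apply/andP; split; lra.
have [g1l g1r] := andP g1.
have ends s z : test_ge0 g h sg c0 s z -> [/\ 0 <= sg * (s.[z] - c0),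
    0 <= sg * (s.[z + h / 2 * (1 + g)] - c0) & 0 <= sg * (s.[z + h] - c0)].
  move=> hs.
  have el : z + h / 2 * (1 + -1) = z by rewrite subrr mulr0 addr0.
  have er : z + h / 2 * (1 + 1) = z + h by field.
  split; last by rewrite -er; apply: hs; constructor 3.
    by rewrite -el; apply: hs; constructor 1.
  by apply: hs; constructor 2.
have [p1 p2 p3] := ends _ _ p0; have [q1 q2 q3] := ends _ _ q0.
have [r1 r2 r3] := ends _ _ r0.
have := interval_update_ge F hg har hal p1 p2 p3 q1 q2 q3 r1 r2 r3.
rewrite (interval_average xl sp h0 g1).
rewrite (interface_derivativeE b0 b1 xl xl' sp sq h0 g1).
rewrite (interface_derivativeE b0 b1 xl'' xl sr sp h0 g1).
rewrite addrA => /le_trans; apply; rewrite le_eqVlt; apply/orP; left; apply/eqP.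
rewrite /value_average /value_flux /second_difference.
field; do ?[apply/andP; split]; try by apply/eqP; lra.
by rewrite lt0r_neq0 //; nra.
Qed.

End OneDimension.

(** * Slices of a piecewise polynomial function *)

Section Slices.
Variables (R : realType) (M : mesh R).
Implicit Types (v : dgfun M) (i : 'I_(nx M)) (j : 'I_(ny M)) (x y : R).

(** The polynomial in x, for fixed y, that [ev] evaluates on a cell, and below
    the one in y for fixed x. *)
Definition xslice v i j y : {poly R} := map_poly (horner_eval y) (v i j).
Definition yslice v i j x : {poly R} := (v i j).[x%:P].

Lemma ev_xslice v i j x y : ev v i j x y = (xslice v i j y).[x].
Proof.
rewrite /ev /xslice -[X in (map_poly _ _).[X]](hornerC x y).
by rewrite -[X in _ = (_).[X]]/(horner_eval y x%:P) horner_map.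
Qed.

Lemma ev_yslice v i j x y : ev v i j x y = (yslice v i j x).[y].
Proof. by []. Qed.

Lemma xslice_Dx v i j y : xslice (Dx v) i j y = (xslice v i j y)^`().
Proof. by rewrite /xslice deriv_map. Qed.

Lemma yslice_Dy v i j x : yslice (Dy v) i j x = (yslice v i j x)^`().
Proof.
rewrite /yslice /Dy (horner_coef_wide _ (size_poly _ _)) horner_coef raddf_sum.
apply: eq_bigr => l _; rewrite coef_map_id0 ?deriv0 // -polyC_exp.
by rewrite /= derivM derivC mulr0 addr0.
Qed.

Lemma size_xslice v k i j y : in_Vh k v -> (size (xslice v i j y) <= k.+1)%N.
Proof. by move=> /(_ i j)[sv _]; apply: leq_trans (size_poly _ _) sv. Qed.

Lemma size_yslice v k i j x : in_Vh k v -> (size (yslice v i j x) <= k.+1)%N.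
Proof.
move=> /(_ i j)[_ sv]; rewrite /yslice horner_coef.
apply: leq_trans (size_sum _ _ _) _; apply/bigmax_leqP => l _.
by rewrite -polyC_exp mulrC mul_polyC (leq_trans (size_scale_leq _ _)).
Qed.

End Slices.

(** * Tangential derivatives on a face *)

Section Faces.
Variable R : realType.

Lemma bounded_Rintegral_le (f : R -> R) (K a b : R) : a < b ->
  measurable_fun `[a, b] f -> (forall x, a <= x <= b -> `|f x| <= K) ->
  `|\int[lebesgue_measure]_(x in `[a, b]) f x| <= K * (b - a).
Proof.
move=> ab mf fK.
have muE : lebesgue_measure `[a, b]%classic = (b - a)%:E.
  by rewrite lebesgue_measure_itv /= lte_fin ab -EFinD.
have mab : (lebesgue_measure `[a, b]%classic < +oo)%E by rewrite muE ltry.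
have intf (g : R -> R) : measurable_fun `[a, b] g ->
    (forall x, a <= x <= b -> `|g x| <= K) ->
    lebesgue_measure.-integrable `[a, b] (EFin \o g).
  move=> mg gK; apply: measurable_bounded_integrable => //.
  exists K; split; first exact: num_real.
  move=> M KM x /=; rewrite in_itv /= => xab; exact: le_trans (gK _ xab) (ltW KM).
apply: le_trans (le_normr_Rintegral _ (intf _ mf fK)) _ => //.
have -> : K * (b - a) = \int[lebesgue_measure]_(x in `[a, b]) K.
  by rewrite Rintegral_cst // -[b - a]/(fine (b - a)%:E) -muE.
have K0 : 0 <= K by apply: (le_trans (normr_ge0 (f a))); apply: fK; rewrite lexx ltW.
apply: le_Rintegral => //.
- apply: intf; first exact: measurableT_comp.
  by move=> x; rewrite normr_id; exact: fK.
- by apply: intf => // x _; rewrite /= ger0_norm.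
Qed.

(** [gauss_lobatto_derivative_bound] transported to an interval of length h
    starting at yl. *)
Lemma quadratic_derivative_bound (L : nat) (node weight : 'I_L -> R)
    (p : {poly R}) (yl h sg c0 y : R) :
  gauss_lobatto node weight -> (3 <= L)%N -> (size p <= 3)%N -> 0 < h ->
  `|sg| = 1 -> yl <= y <= yl + h ->
  (forall s, 0 <= sg * (p.[yl + h / 2 * (1 + node s)] - c0)) ->
  `|p^`().[y]| <= 4 * (L * L.-1)%:R / h *
    \sum_s weight s * (sg * (p.[yl + h / 2 * (1 + node s)] - c0)).
Proof.
move=> hGL hL sp h0 sg1 /andP[y0 y1] pge0.
pose z : {poly R} := (yl + h / 2)%:P + (h / 2) *: 'X.
pose q := sg *: (p \Po z - c0%:P).
have hz t : z.[t] = yl + h / 2 * (1 + t) by rewrite !hornerE; ring.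
have hq t : q.[t] = sg * (p.[yl + h / 2 * (1 + t)] - c0).
  by rewrite !hornerE horner_comp hz.
have sq : (size q <= 3)%N.
  apply: leq_trans (size_scale_leq _ _) _.
  apply: leq_trans (size_polyD _ _) _; rewrite geq_max size_polyN.
  rewrite (leq_trans (size_polyC_leq1 _)) // andbT.
  apply: leq_trans (size_comp_poly_leq _ _) _.
  have sz : (size z <= 2)%N.
    apply: leq_trans (size_polyD _ _) _; rewrite geq_max.
    rewrite (leq_trans (size_polyC_leq1 _)) //=.
    by rewrite (leq_trans (size_scale_leq _ _)) // size_polyX.
  by rewrite ltnS (@leq_mul _ _ 2 1) // -subn1 leq_subLR.
have dz : z^`() = (h / 2)%:P.
  by rewrite derivD derivC derivZ derivX add0r alg_polyC.
pose t := 2 / h * (y - yl) - 1.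
have yt : yl + h / 2 * (1 + t) = y by rewrite /t; field; apply/eqP; lra.
have dq : q^`().[t] = sg * p^`().[y] * (h / 2).
  by rewrite derivZ derivB derivC subr0 deriv_comp dz !hornerE horner_comp hz yt.
have t1 : -1 <= t <= 1.
  have h2 : 0 <= 2 / h by rewrite divr_ge0 // ltW.
  have e : 2 / h * h = 2 by field; apply/eqP; lra.
  by rewrite /t; apply/andP; split; nra.
have qge0 s : 0 <= q.[node s] by rewrite hq.
have := gauss_lobatto_derivative_bound hGL hL sq qge0 t1.
rewrite dq normrM (ger0_norm (_ : 0 <= h / 2)); last lra.
rewrite normrM sg1 mul1r.
rewrite -ler_pdivlMr; last lra.
rewrite (eq_bigr (fun s => weight s * (sg * (p.[yl + h / 2 * (1 + node s)] - c0)))).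
  by move=> hh; apply: le_trans hh _; rewrite le_eqVlt; apply/orP; left; apply/eqP; field;
    apply/eqP; lra.
by move=> s _; rewrite hq.
Qed.

End Faces.

Section FaceIntegral.
Variable R : realType.

(** The shape of each of the four integrals in the mixed term: f is the
    averaged coefficient and p, q are the two traces along an edge. *)
Lemma face_integral_bound (L : nat) (node weight : 'I_L -> R)
    (f : R -> R) (p q : {poly R}) (yl h sg c0 C : R) :
  gauss_lobatto node weight -> (3 <= L)%N ->
  (size p <= 3)%N -> (size q <= 3)%N -> 0 < h -> `|sg| = 1 ->
  measurable_fun `[yl, yl + h] f -> (forall y, yl <= y <= yl + h -> `|f y| <= C) ->
  (forall s, 0 <= sg * (p.[yl + h / 2 * (1 + node s)] - c0)) ->
  (forall s, 0 <= sg * (q.[yl + h / 2 * (1 + node s)] - c0)) ->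
  `|\int[lebesgue_measure]_(y in `[yl, yl + h]) (f y * ((p^`().[y] + q^`().[y]) / 2))|
  <= 2 * C * (L * L.-1)%:R *
     \sum_s weight s * (sg * (p.[yl + h / 2 * (1 + node s)] - c0)
                        + sg * (q.[yl + h / 2 * (1 + node s)] - c0)).
Proof.
move=> hGL hL sp sq h0 sg1 mf fC p0 q0.
under eq_bigr do rewrite mulrDr.
rewrite big_split /=.
set P := \sum_s weight s * (sg * (p.[_] - c0)); set Q := \sum_s _.
set N := (L * L.-1)%:R.
have hp y (hy : yl <= y <= yl + h) : `|p^`().[y]| <= 4 * N / h * P.
  exact: quadratic_derivative_bound.
have hq y (hy : yl <= y <= yl + h) : `|q^`().[y]| <= 4 * N / h * Q.
  exact: quadratic_derivative_bound.
have yl_in : yl <= yl <= yl + h by rewrite lexx lerDl ltW.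
have C0 : 0 <= C by exact: le_trans (fC _ yl_in).
have ab : yl < yl + h by rewrite ltrDl.
rewrite [leRHS](_ : _ = C * (2 * N / h * (P + Q)) * (yl + h - yl)); last first.
  by field; apply/eqP; lra.
apply: bounded_Rintegral_le => // [|y hy].
  apply: measurable_funM => //.
  apply: (eq_measurable_fun (horner (2^-1 *: (p^`() + q^`())))).
    by move=> y _; rewrite !hornerE mulrC.
  exact: measurable_poly.
rewrite normrM; apply: ler_pM => //; first exact: fC.
rewrite normrM (ger0_norm (_ : 0 <= 2^-1)) ?invr_ge0 //.
rewrite ler_pdivrMr //; apply: le_trans (ler_normD _ _) _.
apply: le_trans (lerD (hp _ hy) (hq _ hy)) _; rewrite le_eqVlt; apply/orP; left.
by apply/eqP; field; apply/eqP; lra.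
Qed.

End FaceIntegral.

(** * Geometry of the mesh *)

Section MeshGeometry.
Variables (R : realType) (M : mesh R).
Implicit Types (i : 'I_(nx M)) (j : 'I_(ny M)) (x y t : R).

Lemma dx_gt0 : 0 < dx M.
Proof. by case: M => ? ? ? ? ? ? h ? hn ?; apply: divr_gt0; rewrite ?subr_gt0 ?ltr0n. Qed.

Lemma dy_gt0 : 0 < dy M.
Proof. by case: M => ? ? ? ? ? ? ? h ? hn; apply: divr_gt0; rewrite ?subr_gt0 ?ltr0n. Qed.

Lemma xrightE i : xright i = xleft i + dx M.
Proof. by rewrite /xright /xleft -addn1 natrD mulrDl mul1r addrA. Qed.

Lemma ytopE j : ytop j = ybot j + dy M.
Proof. by rewrite /ytop /ybot -addn1 natrD mulrDl mul1r addrA. Qed.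

Lemma xcenterE i t : xcenter i + dx M / 2 * t = xleft i + dx M / 2 * (1 + t).
Proof. by rewrite /xcenter xrightE; field. Qed.

Lemma ycenterE j t : ycenter j + dy M / 2 * t = ybot j + dy M / 2 * (1 + t).
Proof. by rewrite /ycenter ytopE; field. Qed.

Lemma cellx_sub i x : xleft i <= x <= xleft i + dx M -> xmin M <= x <= xmax M.
Proof.
move=> /andP[h0 h1]; have d0 := dx_gt0; apply/andP; split.
  by apply: le_trans h0; rewrite lerDl mulr_ge0 // ltW.
apply: le_trans h1 _; rewrite -xrightE /xright -lerBrDl.
have n0 : (nx M)%:R != 0 :> R by rewrite pnatr_eq0 -lt0n (leq_ltn_trans _ (ltn_ord i)).
rewrite -[leRHS](divfK n0) -/(dx M) mulrC ler_wpM2l ?(ltW d0) // ler_nat.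
exact: ltn_ord.
Qed.

Lemma celly_sub j y : ybot j <= y <= ybot j + dy M -> ymin M <= y <= ymax M.
Proof.
move=> /andP[h0 h1]; have d0 := dy_gt0; apply/andP; split.
  by apply: le_trans h0; rewrite lerDl mulr_ge0 // ltW.
apply: le_trans h1 _; rewrite -ytopE /ytop -lerBrDl.
have n0 : (ny M)%:R != 0 :> R by rewrite pnatr_eq0 -lt0n (leq_ltn_trans _ (ltn_ord j)).
rewrite -[leRHS](divfK n0) -/(dy M) mulrC ler_wpM2l ?(ltW d0) // ler_nat.
exact: ltn_ord.
Qed.

Lemma measurable_Omega : measurable (Omega M).
Proof. by apply: measurableX; exact: measurable_itv. Qed.

(** The averaged coefficient on an edge must be measurable for its integral
    against a tangential derivative to be bounded by the integral of the
    absolute value. *)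
Lemma measurable_coef_vertical (f : R -> R -> R -> R) (p : {poly R}) x a b :
  measurable_coef M f -> (forall y, a <= y <= b -> Omega M (x, y)) ->
  measurable_fun `[a, b] (fun y => f x y p.[y]).
Proof.
move=> mf inO.
apply: (measurable_comp (F := Omega M `*` [set: R])
  (f := fun z : R * R * R => f z.1.1 z.1.2 z.2) (g := fun y => (x, y, p.[y]))) => //.
- by apply: measurableX => //; exact: measurable_Omega.
- by move=> _ [y /= +] <-; rewrite in_itv => /inO; split.
apply: measurable_funTS; apply: measurable_fun_pair; last exact: measurable_poly.
by apply: measurable_fun_pair => //; exact: measurable_cst.
Qed.

Lemma measurable_coef_horizontal (f : R -> R -> R -> R) (p : {poly R}) y a b :
  measurable_coef M f -> (forall x, a <= x <= b -> Omega M (x, y)) ->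
  measurable_fun `[a, b] (fun x => f x y p.[x]).
Proof.
move=> mf inO.
apply: (measurable_comp (F := Omega M `*` [set: R])
  (f := fun z : R * R * R => f z.1.1 z.1.2 z.2) (g := fun x => (x, y, p.[x]))) => //.
- by apply: measurableX => //; exact: measurable_Omega.
- by move=> _ [x /= +] <-; rewrite in_itv => /inO; split.
apply: measurable_funTS; apply: measurable_fun_pair; last exact: measurable_poly.
by apply: measurable_fun_pair => //; exact: measurable_cst.
Qed.

End MeshGeometry.

(** * Update of a cell *)

Section CellUpdate.
Variables (R : realType) (M : mesh R).
Variables (L : nat) (node weight : 'I_L -> R).
Implicit Types (u : dgfun M) (i : 'I_(nx M)) (j : 'I_(ny M)) (x y t sg : R).

Definition test_values_ge0 (gx gy sg c0 : R) u : Prop :=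
  forall i j x y, test_set node gx gy i j (x, y) -> 0 <= sg * (ev u i j x y - c0).

Lemma xslice_test_ge0 gx gy sg c0 u i j s : test_values_ge0 gx gy sg c0 u ->
  test_ge0 gx (dx M) sg c0 (xslice u i j (yhat node j s)) (xleft i).
Proof.
move=> h t ht; rewrite -ev_xslice -xcenterE; apply: h; left; split; last by exists s.
by exists t => //=; case: ht => ->; [left; left|left; right|right].
Qed.

Lemma yslice_test_ge0 gx gy sg c0 u i j s : test_values_ge0 gx gy sg c0 u ->
  test_ge0 gy (dy M) sg c0 (yslice u i j (xhat node i s)) (ybot j).
Proof.
move=> h t ht; rewrite -ev_yslice -ycenterE; apply: h; right; split; first by exists s.
by exists t => //=; case: ht => ->; [left; left|left; right|right].
Qed.

Lemma right_node_ge0 gx gy sg c0 u i j s : test_values_ge0 gx gy sg c0 u ->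
  0 <= sg * (ev u i j (xright i) (yhat node j s) - c0).
Proof.
move=> ht; have := @xslice_test_ge0 _ _ _ _ _ i j s ht 1; rewrite ev_xslice xrightE.
rewrite (_ : dx M / 2 * (1 + 1) = dx M); last by field.
by apply; constructor 3.
Qed.

Lemma left_node_ge0 gx gy sg c0 u i j s : test_values_ge0 gx gy sg c0 u ->
  0 <= sg * (ev u i j (xleft i) (yhat node j s) - c0).
Proof.
move=> ht; have := @xslice_test_ge0 _ _ _ _ _ i j s ht (-1); rewrite ev_xslice subrr mulr0 addr0.
by apply; constructor 1.
Qed.

Lemma top_node_ge0 gx gy sg c0 u i j s : test_values_ge0 gx gy sg c0 u ->
  0 <= sg * (ev u i j (xhat node i s) (ytop j) - c0).
Proof.
move=> ht; have := @yslice_test_ge0 _ _ _ _ _ i j s ht 1; rewrite ev_yslice ytopE.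
rewrite (_ : dy M / 2 * (1 + 1) = dy M); last by field.
by apply; constructor 3.
Qed.

Lemma bot_node_ge0 gx gy sg c0 u i j s : test_values_ge0 gx gy sg c0 u ->
  0 <= sg * (ev u i j (xhat node i s) (ybot j) - c0).
Proof.
move=> ht; have := @yslice_test_ge0 _ _ _ _ _ i j s ht (-1); rewrite ev_yslice subrr mulr0 addr0.
by apply; constructor 1.
Qed.

Lemma H1_ge (a : R -> R -> R -> R) (b0 b1 gam amin amax S tau gx sg c0 y : R) u i j :
  flux_condition b0 b1 gam amin amax (mu M tau) S -> in_Vh 2 u -> `|gx| <= gam ->
  (forall i, amin <= xavg (oncells a u) i j y <= amax) ->
  (forall i, test_ge0 gx (dx M) sg c0 (xslice u i j y) (xleft i)) ->
  mu M tau * S *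
    (sg * (xminus (ev u) i j y - c0) + sg * (xplus (ev u) i j y - c0)
     + (sg * (xminus (ev u) (ord_pred i) j y - c0)
        + sg * (xplus (ev u) (ord_pred i) j y - c0)))
  <= sg * (H1 a b0 b1 tau u i j y - c0).
Proof.
move=> F hu hg ha ht.
have sz k : (size (xslice u k j y) <= 3)%N by exact: size_xslice.
have fluxE k : xflux_dx b0 b1 u k j y
    = interface_derivative b0 b1 (dx M) (xslice u k j y) (xslice u (ordS k) j y)
        (xleft k + dx M) (xleft (ordS k)).
  rewrite /xflux_dx /interface_derivative /xjump /xavg /xplus /xminus.
  by rewrite !ev_xslice !xslice_Dx xrightE.
have := interval_step_ge F (sz i) (sz (ordS i)) (sz (ord_pred i)) (dx_gt0 M) hg
  (ha i) (ha (ord_pred i)) (ht i) (ht (ordS i)) (ht (ord_pred i)).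
rewrite /H1 !fluxE ord_predK /int_x /cellx xrightE.
rewrite (_ : (fun x => ev u i j x y) = horner (xslice u i j y)); last first.
  by apply/funext => x; rewrite ev_xslice.
move=> /(le_trans _); apply; rewrite /xminus /xplus ord_predK !ev_xslice !xrightE.
by rewrite le_eqVlt; apply/orP; left; apply/eqP; ring.
Qed.

Lemma H2_ge (b : R -> R -> R -> R) (b0 b1 gam amin amax S tau gy sg c0 x : R) u i j :
  flux_condition b0 b1 gam amin amax (mu M tau) S -> in_Vh 2 u -> `|gy| <= gam ->
  (forall j, amin <= yavg (oncells b u) i j x <= amax) ->
  (forall j, test_ge0 gy (dy M) sg c0 (yslice u i j x) (ybot j)) ->
  mu M tau * S *
    (sg * (yminus (ev u) i j x - c0) + sg * (yplus (ev u) i j x - c0)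
     + (sg * (yminus (ev u) i (ord_pred j) x - c0)
        + sg * (yplus (ev u) i (ord_pred j) x - c0)))
  <= sg * (H2 b b0 b1 tau u i j x - c0).
Proof.
move=> F hu hg hb ht.
have sz k : (size (yslice u i k x) <= 3)%N by exact: size_yslice.
have fluxE k : yflux_dy b0 b1 u i k x
    = interface_derivative b0 b1 (dy M) (yslice u i k x) (yslice u i (ordS k) x)
        (ybot k + dy M) (ybot (ordS k)).
  rewrite /yflux_dy /interface_derivative /yjump /yavg /yplus /yminus.
  by rewrite !ev_yslice !yslice_Dy ytopE.
have := interval_step_ge F (sz j) (sz (ordS j)) (sz (ord_pred j)) (dy_gt0 M) hg
  (hb j) (hb (ord_pred j)) (ht j) (ht (ordS j)) (ht (ord_pred j)).
rewrite /H2 !fluxE ord_predK /int_y /celly ytopE.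
rewrite (_ : (fun y => ev u i j x y) = horner (yslice u i j x)); last by [].
move=> /(le_trans _); apply; rewrite /yminus /yplus ord_predK !ev_yslice !ytopE.
by rewrite le_eqVlt; apply/orP; left; apply/eqP; ring.
Qed.

(** The quadrature, over the right edge of a cell, of how far the two traces of
    u lie inside the bound.  The one-dimensional updates keep a multiple of it
    in reserve, and it bounds the mixed term. *)
Definition xface_excess sg (c0 : R) u i j : R :=
  \sum_s weight s * (sg * (xminus (ev u) i j (yhat node j s) - c0)
                     + sg * (xplus (ev u) i j (yhat node j s) - c0)).

Definition yface_excess sg (c0 : R) u i j : R :=
  \sum_s weight s * (sg * (yminus (ev u) i j (xhat node i s) - c0)
                     + sg * (yplus (ev u) i j (xhat node i s) - c0)).

Hypothesis hGL : gauss_lobatto node weight.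
Hypothesis L_ge3 : (3 <= L)%N.

Lemma sum_weight : \sum_s weight s = 1.
Proof.
have L1 : (1 <= 2 * L - 2)%N by lia.
have /= := gauss_lobatto_moments hGL (l := [:: 1]) L1 isT.
rewrite !mul0r !addr0 => <-; apply: eq_bigr => s _.
by rewrite mul0r add0r mulr1.
Qed.

(** Weights that are nonnegative and sum to 1 carry the pointwise estimate for
    H1 and H2 over to their quadratures. *)
Lemma quadrature_ge (f e : 'I_L -> R) sg c0 (K : R) :
  (forall s, K * e s <= sg * (f s - c0)) ->
  K * (\sum_s weight s * e s) <= sg * (\sum_s weight s * f s - c0).
Proof.
move=> h; rewrite -[c0]mul1r -sum_weight mulr_suml -sumrB !mulr_sumr.
apply: ler_sum => s _.
rewrite mulrCA [leRHS](_ : _ = weight s * (sg * (f s - c0))); last by ring.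
by rewrite ler_wpM2l // (weight_ge0 hGL).
Qed.

Lemma xface_integral_bound (c : R -> R -> R -> R) (cn gx gy sg c0 : R) u i j :
  measurable_coef M c -> in_Vh 2 u -> `|sg| = 1 -> test_values_ge0 gx gy sg c0 u ->
  (forall i j x y, cell_boundary i j (x, y) -> `|oncells c u i j x y| <= cn) ->
  `|int_y j (fun y => xavg (oncells c u) i j y * xavg (ev (Dy u)) i j y)|
  <= 2 * cn * (L * L.-1)%:R * xface_excess sg c0 u i j.
Proof.
move=> mc hu sg1 ht hc.
have inO (k : 'I_(nx M)) y : ybot j <= y <= ybot j + dy M ->
    Omega M (xright k, y) /\ Omega M (xleft k, y).
  move=> /celly_sub hy; have d0 := ltW (dx_gt0 M).
  by split; split; rewrite /= in_itv //=; apply: (cellx_sub (i := k));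
    rewrite ?xrightE ?lexx ?lerDl ?d0.
have avgE y : xavg (ev (Dy u)) i j y =
    ((yslice u i j (xright i))^`().[y]
     + (yslice u (ordS i) j (xleft (ordS i)))^`().[y]) / 2.
  by rewrite /xavg /xminus /xplus !ev_yslice !yslice_Dy.
have -> : (fun y => xavg (oncells c u) i j y * xavg (ev (Dy u)) i j y) =
  (fun y => xavg (oncells c u) i j y * (((yslice u i j (xright i))^`().[y]
     + (yslice u (ordS i) j (xleft (ordS i)))^`().[y]) / 2)).
  by apply/funext => y; rewrite avgE.
rewrite /xface_excess /xminus /xplus /int_y /celly ytopE.
under [in leRHS]eq_bigr do rewrite !ev_yslice /yhat ycenterE.
apply: face_integral_bound => //.
- exact: size_yslice.
- exact: size_yslice.
- exact: dy_gt0.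
- apply: (eq_measurable_fun (fun y => 2^-1 * (oncells c u i j (xright i) y
      + oncells c u (ordS i) j (xleft (ordS i)) y))).
    by move=> y _; rewrite mulrC.
  apply: measurable_funM => //; apply: measurable_funD.
    by apply: (measurable_coef_vertical _ mc) => y hy; exact: (inO i y hy).1.
  by apply: (measurable_coef_vertical _ mc) => y hy; exact: (inO (ordS i) y hy).2.
- move=> y hy; rewrite /xavg normrM (ger0_norm (_ : 0 <= 2^-1)) ?invr_ge0 //.
  rewrite ler_pdivrMr //; apply: le_trans (ler_normD _ _) _.
  rewrite [leRHS](_ : _ = cn + cn); last by ring.
  have hyj : celly j y by rewrite /celly /= in_itv /= ytopE.
  by apply: lerD; apply: hc; left; split => //; [right | left].
- by move=> s; rewrite -ycenterE -ev_yslice; exact: right_node_ge0 ht.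
- by move=> s; rewrite -ycenterE -ev_yslice; exact: left_node_ge0 ht.
Qed.

Lemma yface_integral_bound (c : R -> R -> R -> R) (cn gx gy sg c0 : R) u i j :
  measurable_coef M c -> in_Vh 2 u -> `|sg| = 1 -> test_values_ge0 gx gy sg c0 u ->
  (forall i j x y, cell_boundary i j (x, y) -> `|oncells c u i j x y| <= cn) ->
  `|int_x i (fun x => yavg (oncells c u) i j x * yavg (ev (Dx u)) i j x)|
  <= 2 * cn * (L * L.-1)%:R * yface_excess sg c0 u i j.
Proof.
move=> mc hu sg1 ht hc.
have inO (k : 'I_(ny M)) x : xleft i <= x <= xleft i + dx M ->
    Omega M (x, ytop k) /\ Omega M (x, ybot k).
  move=> /cellx_sub hx; have d0 := ltW (dy_gt0 M).
  by split; split; rewrite /= in_itv //=; apply: (celly_sub (j := k));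
    rewrite ?ytopE ?lexx ?lerDl ?d0.
have -> : (fun x => yavg (oncells c u) i j x * yavg (ev (Dx u)) i j x) =
  (fun x => yavg (oncells c u) i j x * (((xslice u i j (ytop j))^`().[x]
     + (xslice u i (ordS j) (ybot (ordS j)))^`().[x]) / 2)).
  apply/funext => x.
  by rewrite /yavg /yminus /yplus ![ev (Dx _) _ _ _ _]ev_xslice !xslice_Dx.
rewrite /yface_excess /yminus /yplus /int_x /cellx xrightE.
under [in leRHS]eq_bigr do rewrite !ev_xslice /xhat xcenterE.
have measc k z : (forall x, xleft i <= x <= xleft i + dx M -> Omega M (x, z)) ->
    measurable_fun `[xleft i, xleft i + dx M] (fun x => oncells c u i k x z).
  move=> hz; rewrite (_ : (fun x => _) = (fun x => c x z (xslice u i k z).[x])).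
    exact: (measurable_coef_horizontal _ mc hz).
  by apply/funext => x; rewrite /oncells ev_xslice.
apply: face_integral_bound => //.
- exact: size_xslice.
- exact: size_xslice.
- exact: dx_gt0.
- apply: (eq_measurable_fun (fun x => 2^-1 * (oncells c u i j x (ytop j)
      + oncells c u i (ordS j) x (ybot (ordS j))))).
    by move=> x _; rewrite mulrC.
  apply: measurable_funM => //; apply: measurable_funD.
    by apply: measc => x hx; exact: (inO j x hx).1.
  by apply: measc => x hx; exact: (inO (ordS j) x hx).2.
- move=> x hx; rewrite /yavg normrM (ger0_norm (_ : 0 <= 2^-1)) ?invr_ge0 //.
  rewrite ler_pdivrMr //; apply: le_trans (ler_normD _ _) _.
  rewrite [leRHS](_ : _ = cn + cn); last by ring.
  have hxi : cellx i x by rewrite /cellx /= in_itv /= xrightE.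
  by apply: lerD; apply: hc; right; split => //; [right | left].
- by move=> s; rewrite -xcenterE -ev_xslice; exact: top_node_ge0 ht.
- by move=> s; rewrite -xcenterE -ev_xslice; exact: bot_node_ge0 ht.
Qed.

Lemma mixed_term_bound (c : R -> R -> R -> R) (cn gx gy sg c0 tau : R) u i j :
  measurable_coef M c -> in_Vh 2 u -> `|sg| = 1 -> test_values_ge0 gx gy sg c0 u ->
  (forall i j x y, cell_boundary i j (x, y) -> `|oncells c u i j x y| <= cn) ->
  0 <= tau ->
  `|mixed_term c tau u i j| <= tau / (dx M * dy M) * (2 * cn * (L * L.-1)%:R) *
    (xface_excess sg c0 u i j + xface_excess sg c0 u (ord_pred i) j
     + (yface_excess sg c0 u i j + yface_excess sg c0 u i (ord_pred j))).
Proof.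
move=> mc hu sg1 ht hc tau0.
have hx k := xface_integral_bound k j mc hu sg1 ht hc.
have hy k := yface_integral_bound i k mc hu sg1 ht hc.
have d0 : 0 <= tau / (dx M * dy M).
  by rewrite divr_ge0 // mulr_ge0 // ltW // ?dx_gt0 ?dy_gt0.
rewrite /mixed_term normrM (ger0_norm d0) -mulrA ler_wpM2l // !mulrDr.
apply: le_trans (ler_normD _ _) _.
by apply: lerD; apply: le_trans (ler_normB _ _) _; apply: lerD.
Qed.

Lemma xface_excess_ge0 gx gy sg c0 u i j : test_values_ge0 gx gy sg c0 u ->
  0 <= xface_excess sg c0 u i j.
Proof.
move=> ht; apply: sumr_ge0 => s _; rewrite mulr_ge0 ?(weight_ge0 hGL) //.
by apply: addr_ge0; [exact: right_node_ge0 ht | exact: left_node_ge0 ht].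
Qed.

Lemma yface_excess_ge0 gx gy sg c0 u i j : test_values_ge0 gx gy sg c0 u ->
  0 <= yface_excess sg c0 u i j.
Proof.
move=> ht; apply: sumr_ge0 => s _; rewrite mulr_ge0 ?(weight_ge0 hGL) //.
by apply: addr_ge0; [exact: top_node_ge0 ht | exact: bot_node_ge0 ht].
Qed.

End CellUpdate.

(** * Extended real bounds on the parameters *)

Lemma nonneg_definite_diag (R : realType) (a b c : R) :
  nonneg_definite (sym2 a b c) -> 0 <= a /\ 0 <= b.
Proof.
move=> h; split; [have := h (vec2 1 0) | have := h (vec2 0 1)];
  rewrite /dot !mxE !big_ord_recr big_ord0 /= !mxE !big_ord_recr !big_ord0 /= !mxE /=;
  by rewrite !(mul0r, mulr0, mul1r, mulr1, add0r, addr0).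
Qed.

Section ExtendedQuotients.
Variable R : realType.
Implicit Types (m r d : R).

Lemma ediv_gt0 r d : 0 < r -> 0 <= d -> (0 < r%:E / d%:E)%E.
Proof.
move=> r0 d0; rewrite inver; case: eqP => [_|/eqP dn0].
  by rewrite gt0_muley ?lte_fin.
by rewrite -EFinM lte_fin divr_gt0 // lt0r dn0.
Qed.

Lemma le_ediv m r d : 0 <= r -> 0 <= d -> (m%:E <= r%:E / d%:E)%E -> m * d <= r.
Proof.
move=> r0 d0; rewrite inver; case: eqP => [->|/eqP dn0]; first by rewrite mulr0.
by rewrite -EFinM lee_fin ler_pdivlMr // lt0r dn0.
Qed.

(** For d = 0 the quotient is +oo unless r = 0, so the conclusion then says
    r = 0. *)
Lemma ediv_le m r d : 0 <= r -> 0 <= d -> (1 + r%:E / d%:E <= m%:E)%E ->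
  1 <= m /\ r <= d * (m - 1).
Proof.
move=> r0 d0; rewrite inver; case: eqP => [->|/eqP dn0].
  move: r0; rewrite le_eqVlt => /predU1P[<-|r0].
    by rewrite mul0e adde0 lee_fin mul0r.
  by rewrite gt0_muley ?lte_fin.
have dp : 0 < d by rewrite lt0r dn0.
rewrite -EFinM lee_fin => h; split.
  by apply: le_trans h; rewrite lerDl divr_ge0.
by rewrite mulrC -ler_pdivrMr // lerBrDl.
Qed.

End ExtendedQuotients.

(** * Bounds for the cell averages *)

(** The mixed term carries the factor tau / (dx dy), the reserve in the x
    direction the factor mu_x = tau / dx^2 and that in the y direction
    mu_y = tau / dy^2.  Shape regularity compares them at the cost of kappa. *)
Lemma average_update_ge (R : realType) (M : mesh R) (L : nat)
    (node weight : 'I_L -> R) (a b c : R -> R -> R -> R)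
    (b0 b1 gam amin amax S cn kappa tau gx gy sg c0 : R) (u : dgfun M) i j :
  gauss_lobatto node weight -> (3 <= L)%N -> in_Vh 2 u -> 0 < tau ->
  flux_condition b0 b1 gam amin amax (mu M tau) S ->
  `|gx| <= gam -> `|gy| <= gam ->
  (forall i j s, amin <= xavg (oncells a u) i j (yhat node j s) <= amax) ->
  (forall i j s, amin <= yavg (oncells b u) i j (xhat node i s) <= amax) ->
  measurable_coef M c ->
  (forall i j x y, cell_boundary i j (x, y) -> `|oncells c u i j x y| <= cn) ->
  0 <= cn -> kappa^-1 <= dx M / dy M <= kappa -> 0 < kappa ->
  2 * kappa * cn * (L * L.-1)%:R <= S ->
  `|sg| = 1 -> test_values_ge0 node gx gy sg c0 u ->
  0 <= sg * (average_update a b c b0 b1 node weight tau u i j - c0).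
Proof.
move=> hGL hL hu tau0 F hgx hgy ha hb mc hc cn0 /andP[k1 k2] k0 hS sg1 ht.
have dx0 := dx_gt0 M; have dy0 := dy_gt0 M.
set X := xface_excess node weight sg c0 u i j
  + xface_excess node weight sg c0 u (ord_pred i) j.
set Y := yface_excess node weight sg c0 u i j
  + yface_excess node weight sg c0 u i (ord_pred j).
have hX : mu M tau * S * X
    <= sg * (\sum_s weight s * H1 a b0 b1 tau u i j (yhat node j s) - c0).
  rewrite /X /xface_excess -big_split /=.
  under eq_bigr do rewrite -mulrDr.
  apply: (quadrature_ge hGL hL) => s.
  apply: (H1_ge i F hu hgx) => k; first exact: ha.
  exact: xslice_test_ge0 ht.
have hY : mu M tau * S * Y
    <= sg * (\sum_s weight s * H2 b b0 b1 tau u i j (xhat node i s) - c0).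
  rewrite /Y /yface_excess -big_split /=.
  under eq_bigr do rewrite -mulrDr.
  apply: (quadrature_ge hGL hL) => s.
  apply: (H2_ge j F hu hgy) => k; first exact: hb.
  exact: yslice_test_ge0 ht.
have hB := mixed_term_bound hGL hL i j mc hu sg1 ht hc (ltW tau0).
have X0 : 0 <= X by rewrite addr_ge0 // (xface_excess_ge0 hGL hL _ _ ht).
have Y0 : 0 <= Y by rewrite addr_ge0 // (yface_excess_ge0 hGL hL _ _ ht).
rewrite -/X -/Y in hB.
have mx0 : 0 < mu_x M tau by rewrite divr_gt0 // exprn_gt0.
have my0 : 0 < mu_y M tau by rewrite divr_gt0 // exprn_gt0.
have mu_gt0 : 0 < mu M tau by rewrite addr_gt0.
have mun : mu M tau != 0 by rewrite lt0r_neq0.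
have hxk : tau / (dx M * dy M) <= mu_x M tau * kappa.
  have -> : tau / (dx M * dy M) = mu_x M tau * (dx M / dy M).
    by rewrite /mu_x; field; rewrite !lt0r_neq0.
  by rewrite ler_wpM2l // ltW.
have hyk : tau / (dx M * dy M) <= mu_y M tau * kappa.
  have -> : tau / (dx M * dy M) = mu_y M tau * (dx M / dy M)^-1.
    by rewrite /mu_y; field; rewrite !lt0r_neq0.
  rewrite ler_wpM2l ?(ltW my0) // -[leRHS]invrK lef_pV2 // posrE ?invr_gt0 //.
  by rewrite divr_gt0.
set N := (L * L.-1)%:R in hS hB *.
have share m Z : 0 <= Z -> 0 <= m -> tau / (dx M * dy M) <= m * kappa ->
    tau / (dx M * dy M) * (2 * cn * N) * Z <= m * S * Z.
  move=> Z0 m0 hm; rewrite ler_wpM2r //.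
  apply: (@le_trans _ _ (m * kappa * (2 * cn * N))).
    by rewrite ler_wpM2r // !mulr_ge0.
  rewrite [leLHS](_ : _ = m * (2 * kappa * cn * N)); last by ring.
  by rewrite ler_wpM2l.
have sx := share _ _ X0 (ltW mx0) hxk; have sy := share _ _ Y0 (ltW my0) hyk.
have -> : sg * (average_update a b c b0 b1 node weight tau u i j - c0)
  = mu_x M tau / mu M tau
      * (sg * (\sum_s weight s * H1 a b0 b1 tau u i j (yhat node j s) - c0))
    + mu_y M tau / mu M tau
      * (sg * (\sum_s weight s * H2 b b0 b1 tau u i j (xhat node i s) - c0))
    + sg * mixed_term c tau u i j.
  have e : mu_x M tau / mu M tau + mu_y M tau / mu M tau = 1.
    by rewrite -mulrDl -/(mu M tau) divff.
  rewrite /average_update -[in LHS](mul1r c0) -e; ring.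
have hX' : mu_x M tau * S * X <= mu_x M tau / mu M tau
      * (sg * (\sum_s weight s * H1 a b0 b1 tau u i j (yhat node j s) - c0)).
  rewrite [leLHS](_ : _ = mu_x M tau / mu M tau * (mu M tau * S * X)); last by field.
  by rewrite ler_wpM2l // divr_ge0 // ltW.
have hY' : mu_y M tau * S * Y <= mu_y M tau / mu M tau
      * (sg * (\sum_s weight s * H2 b b0 b1 tau u i j (xhat node i s) - c0)).
  rewrite [leLHS](_ : _ = mu_y M tau / mu M tau * (mu M tau * S * Y)); last by field.
  by rewrite ler_wpM2l // divr_ge0 // ltW.
have hB' : - (tau / (dx M * dy M) * (2 * cn * N) * (X + Y))
    <= sg * mixed_term c tau u i j.
  rewrite lerNl; apply: le_trans hB; apply: le_trans (ler_norm _) _.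
  by rewrite normrN normrM sg1 mul1r.
rewrite mulrDr in hB'.
move: (mu_x M tau / mu M tau * _) (mu_y M tau / mu M tau * _) hX' hY' hB' => A B.
by lra.
Qed.

Theorem theorem3p2 (R : realType) (M : mesh R)
  (a b c : R -> R -> R -> R)
  (c1 c2 cnorm abmin abmax kappa beta0 beta1 gammax gammay gamma : R)
  (L : nat) (node weight : 'I_L -> R) (u : dgfun M)
  (hc12 : c1 <= c2)
  (hA : forall x y t, Omega M (x, y) ->
     nonneg_definite (sym2 (a x y t) (b x y t) (c x y t)))
  (ha : measurable_coef M a) (hb : measurable_coef M b)
  (hc : measurable_coef M c)
  (hcnorm : is_max [set `|t| | t in coef_values M c1 c2 c] cnorm)
  (habmin : is_min (coef_values M c1 c2 a `|` coef_values M c1 c2 b) abmin)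
  (habmax : is_max (coef_values M c1 c2 a `|` coef_values M c1 c2 b) abmax)
  (hkappa : 0 < kappa)
  (hregular : kappa^-1 <= dx M / dy M <= kappa)
  (hL : (2 + 3 <= 2 * L)%N)
  (hGL : gauss_lobatto node weight)
  (hgammax : - 3^-1 < gammax < 3^-1) (hgammay : - 3^-1 < gammay < 3^-1)
  (hgamma : gamma = Num.max `|gammax| `|gammay|)
  (hgamma_beta1 : gamma <= 8 * beta1 - 1)
  (hbeta0 : (beta0_bound L kappa cnorm abmin gamma <= beta0%:E)%E)
  (hbeta1 : 8^-1 <= beta1 <= 4^-1)
  (hu : in_Vh 2 u)
  (hu_range : forall i j x y, test_set node gammax gammay i j (x, y) ->
     c1 <= ev u i j x y <= c2)
  (* [mixed_term] evaluates c at every point of the cell edges, where u may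
     leave [c1, c2]; the bound cnorm must hold there as well.  It holds by
     [hcnorm] wherever u lies in [c1, c2]. *)
  (hc_edges : forall i j x y, cell_boundary i j (x, y) ->
     `|oncells c u i j x y| <= cnorm) :
  exists mu0 : \bar R,
    [/\ mu0 = mu0_bound L kappa cnorm abmax beta0 beta1 gamma,
        (0 < mu0)%E &
        forall (tau : R) (unew : dgfun M),
          0 < tau ->
          ddg_step a b c beta0 beta1 node weight 2 tau u unew ->
          ((mu M tau)%:E <= mu0)%E ->
          forall i j, c1 <= cell_average (ev unew) i j <= c2].
Proof.
have L_ge3 : (3 <= L)%N by clear -hL; lia.
have [gx_le gy_le] : `|gammax| <= gamma /\ `|gammay| <= gamma.
  by rewrite hgamma !le_max !lexx orbT.
have gamma0 : 0 <= gamma by apply: le_trans gx_le.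
have gamma_lt : gamma < 3^-1.
  by rewrite hgamma gt_max !ltr_norml hgammax hgammay.
have [b1l b1u] := andP hbeta1.
have coef_in (f : R -> R -> R -> R) x y t : Omega M (x, y) -> c1 <= t <= c2 ->
    coef_values M c1 c2 f (f x y t).
  by move=> hO ht; exists (x, y, t) => //; split => //=; rewrite in_itv.
have ab_ge0 x y t : Omega M (x, y) -> 0 <= a x y t /\ 0 <= b x y t.
  by move=> hO; exact: (nonneg_definite_diag (hA _ _ t hO)).
have amin0 : 0 <= abmin.
  by have [[[[[x y] t] [hO _] <-]|[[[x y] t] [hO _] <-]] _] := habmin;
    have [] := ab_ge0 x y t hO.
have cn0 : 0 <= cnorm by have [[t _ <-] _] := hcnorm.
have amin_le_amax : abmin <= abmax.
  by have [hm _] := habmin; have [_] := habmax; exact.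
have amax0 : 0 <= abmax by exact: le_trans amin_le_amax.
pose N : R := (L * L.-1)%:R.
have N0 : 0 <= N by rewrite ler0n.
have D0 : 0 <= 2 * kappa * cnorm * N by rewrite !mulr_ge0 // ltW.
pose S := 2 * kappa * cnorm * N / (1 - gamma).
(* If abmin = 0 the hypothesis on beta0 forces the off-diagonal bound to be 0,
   so that S = 0. *)
have [beta0_ge1 hS] : 1 <= beta0 /\ S <= abmin * (beta0 - 1).
  have [] := @ediv_le _ beta0 (2 * kappa * cnorm * N) ((1 - gamma) * abmin) D0 _ hbeta0.
    by rewrite mulr_ge0 //; lra.
  by move=> h1 h2; split => //; rewrite /S ler_pdivrMr; lra.
(* As gamma <= 8 beta1 - 1, the numerator is at most 1 - gamma. *)
have hfrac : (2 - 8 * beta1) / (1 + gamma) <= 1 by rewrite ler_pdivrMr; lra.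
pose d1 := 6 * abmax * (beta0 + (8 * beta1 - 2) / (1 + gamma)) * (1 - gamma)
         + 12 * kappa * cnorm * N.
have d1_ge0 : 0 <= d1.
  have : 0 <= beta0 + (8 * beta1 - 2) / (1 + gamma).
    by rewrite -[8 * beta1 - 2]opprB mulNr; lra.
  have k0 := ltW hkappa; have g0 : 0 <= 1 - gamma by lra.
  by move=> h; rewrite addr_ge0 // !mulr_ge0.
pose d2 := 6 * abmax * (1 - 4 * beta1).
have d2_ge0 : 0 <= d2 by rewrite !mulr_ge0 //; lra.
exists (mu0_bound L kappa cnorm abmax beta0 beta1 gamma); split => //.
  rewrite /mu0_bound lt_min; apply/andP; split.
    by apply: ediv_gt0 d1_ge0; lra.
  exact: ediv_gt0 ltr01 d2_ge0.
move=> tau unew tau0 [_ _ avgE]; rewrite /mu0_bound le_min => /andP[mu1 mu2] i j.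
have hmu1 : mu M tau * d1 <= 1 - 3 * gamma by apply: le_ediv d1_ge0 mu1; lra.
have hmu2 : mu M tau * d2 <= 1 by apply: le_ediv d2_ge0 mu2.
have mu_ge0 : 0 <= mu M tau.
  by rewrite addr_ge0 // divr_ge0 ?exprn_ge0 ?ltW ?dx_gt0 ?dy_gt0.
have F : flux_condition beta0 beta1 gamma abmin abmax (mu M tau) S.
  split => //; try lra.
  rewrite ler_pdivlMr; last lra.
  rewrite [leLHS](_ : _ = mu M tau * d1) // /S /d1.
  by field; apply/andP; split; apply/eqP; lra.
have in_range (f : R -> R -> R -> R) x y v : Omega M (x, y) -> c1 <= v <= c2 ->
    coef_values M c1 c2 f `<=` coef_values M c1 c2 a `|` coef_values M c1 c2 b ->
    abmin <= f x y v <= abmax.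
  move=> hO hv sub; have [_ hmin] := habmin; have [_ hmax] := habmax.
  by have /sub h := coef_in f x y v hO hv; rewrite (hmin _ h) (hmax _ h).
have test_lo : test_values_ge0 node gammax gammay 1 c1 u.
  move=> k l x y /hu_range /andP[h _]; rewrite mul1r subr_ge0 //.
have test_hi : test_values_ge0 node gammax gammay (-1) c2 u.
  move=> k l x y /hu_range /andP[_ h]; rewrite mulN1r opprB subr_ge0 //.
have xleft_in (k : 'I_(nx M)) : xmin M <= xleft k <= xmax M.
  by apply: (cellx_sub (i := k)); rewrite lexx lerDl ltW // dx_gt0.
have xright_in (k : 'I_(nx M)) : xmin M <= xright k <= xmax M.
  by apply: (cellx_sub (i := k)); rewrite xrightE lexx lerDl ltW // dx_gt0.
have ybot_in (l : 'I_(ny M)) : ymin M <= ybot l <= ymax M.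
  by apply: (celly_sub (j := l)); rewrite lexx lerDl ltW // dy_gt0.
have ytop_in (l : 'I_(ny M)) : ymin M <= ytop l <= ymax M.
  by apply: (celly_sub (j := l)); rewrite ytopE lexx lerDl ltW // dy_gt0.
have node01 s : 0 <= 2^-1 * (1 + node s) <= 1.
  by have /andP[? ?] := node_itv hGL L_ge3 s; apply/andP; split; lra.
have xhat_in (k : 'I_(nx M)) s : xmin M <= xhat node k s <= xmax M.
  apply: (cellx_sub (i := k)); rewrite /xhat xcenterE lerDl lerD2l -mulrA.
  have /andP[h0 h1] := node01 s; have d0 := ltW (dx_gt0 M).
  by rewrite mulr_ge0 //= -[leRHS]mulr1 ler_wpM2l.
have yhat_in (l : 'I_(ny M)) s : ymin M <= yhat node l s <= ymax M.
  apply: (celly_sub (j := l)); rewrite /yhat ycenterE lerDl lerD2l -mulrA.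
  have /andP[h0 h1] := node01 s; have d0 := ltW (dy_gt0 M).
  by rewrite mulr_ge0 //= -[leRHS]mulr1 ler_wpM2l.
have avg_in (v w : R) : abmin <= v <= abmax -> abmin <= w <= abmax ->
    abmin <= (v + w) / 2 <= abmax.
  by move=> /andP[? ?] /andP[? ?]; apply/andP; split; lra.
have val_in v : 0 <= 1 * (v - c1) -> 0 <= -1 * (v - c2) -> c1 <= v <= c2.
  by move=> ? ?; apply/andP; split; lra.
have in_Omega x y : xmin M <= x <= xmax M -> ymin M <= y <= ymax M -> Omega M (x, y).
  by move=> ? ?; split; rewrite /= in_itv.
have a_in k l s : abmin <= xavg (oncells a u) k l (yhat node l s) <= abmax.
  apply: avg_in; apply: in_range; try exact: subsetUl; try exact: in_Omega.
    by apply: val_in; [apply: right_node_ge0 test_lo | apply: right_node_ge0 test_hi].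
  by apply: val_in; [apply: left_node_ge0 test_lo | apply: left_node_ge0 test_hi].
have b_in k l s : abmin <= yavg (oncells b u) k l (xhat node k s) <= abmax.
  apply: avg_in; apply: in_range; try exact: subsetUr; try exact: in_Omega.
    by apply: val_in; [apply: top_node_ge0 test_lo | apply: top_node_ge0 test_hi].
  by apply: val_in; [apply: bot_node_ge0 test_lo | apply: bot_node_ge0 test_hi].
have S_ge : 2 * kappa * cnorm * (L * L.-1)%:R <= S.
  rewrite /S ler_pdivlMr; last lra.
  by rewrite -[leRHS]mulr1 ler_wpM2l //; lra.
have sg1 : `|1 : R| = 1 by rewrite normr1.
have sgN1 : `|-1 : R| = 1 by rewrite normrN1.
have step sg c0 := @average_update_ge _ _ _ _ _ _ _ _ _ _ _ _ _ _ _ _ _ _ _ sg c0 u i j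
  hGL L_ge3 hu tau0 F gx_le gy_le a_in b_in hc hc_edges cn0 hregular hkappa S_ge.
have lo := step _ _ sg1 test_lo; have hi := step _ _ sgN1 test_hi.
by rewrite avgE; exact: val_in.
Qed.
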